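(* Consider, for $p,q\geq1$, the weighted Birkhoff error term $$\mathbf{Error}_N=\left|\frac1{A_N}\sum_{n=0}^{N-1}w_{p,q}(n/N)f\left(\mathscr{T}_\rho^n(\theta)\right)-\int_{\mathbb{T}^d}f(x)\,dx\right|.$$ Assume that the observable $f$ is ''super-analytic'', meaning that its Fourier coefficients satisfy $|\hat f_k|=\mathcal{O}\left(\exp\left(-|k|^v\right)\right)$ for any $v>1$. Then, for any arbitrarily given $0<\mathbf{a}<1$ and almost all rotations $\rho\in\mathbb{T}^d$, there exist sufficiently large $p,q\geq1$ such that $$\mathbf{Error}_N=\mathcal{O}\left(\exp\left(-c_{\mathrm{IV}}N^{\mathbf{a}}\right)\right),\qquad N\to+\infty,$$ where $c_{\mathrm{IV}}>0$ is some universal constant.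
   Context: Let $d\in\mathbb{N}^+$ and $\mathbb{T}^d=\mathbb{R}^d/\mathbb{Z}^d$. For a rotation vector $\rho\in\mathbb{T}^d$, $\mathscr{T}_\rho(\theta)=\theta+\rho\bmod1$ on $\mathbb{T}^d$, $\theta\in\mathbb{T}^d$ is the initial point, and $f$ is a smooth observable on $\mathbb{T}^d$ with Fourier coefficients $\hat f_k$, $k\in\mathbb{Z}^d$. ''Almost all'' is in the sense of full Lebesgue measure. $|\cdot|$ on $\mathbb{Z}^d$ denotes a fixed norm. For $p,q>0$, $w_{p,q}:\mathbb{R}\to\mathbb{R}$ is defined by $w_{p,q}(x)=\left(\int_0^1\exp(-s^{-p}(1-s)^{-q})\,ds\right)^{-1}\exp(-x^{-p}(1-x)^{-q})$ for $x\in(0,1)$ and $w_{p,q}(x)=0$ for $x\notin(0,1)$; here $A_N=\sum_{n=0}^{N-1}w_{p,q}(n/N)$ (positive for $N\geq2$). $\mathcal{O}$ means bounded in absolute value by a constant multiple (as $N\to+\infty$, respectively $|k|\to+\infty$). *)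

(* Defs.v *)
From HB Require Import structures.
From mathcomp Require Import all_boot all_order all_algebra.
From mathcomp Require Import all_classical all_reals all_analysis.
From mathcomp Require Export complex.
Set Implicit Arguments.
Unset Strict Implicit.
Unset Printing Implicit Defensive.
Import Order.TTheory GRing.Theory Num.Theory.
Import numFieldNormedType.Exports.
Import Normc.
Local Open Scope classical_set_scope.
Local Open Scope complex_scope.
Local Open Scope ring_scope.

(* A point of the torus T^d = R^d / Z^d is given by a representative in R^d,
   and a function on T^d is a Z^d-periodic function on R^d.  The carrier
   'rV[R]_d is used for the normed space structure (differentiability) and the
   carrier d.-tuple R for the product sigma-algebra (measure theory). *)

Definition rv_of_tuple (R : realType) d (x : d.-tuple R) : 'rV[R]_d :=
  \row_i tnth x i.

Definition rv_of_int (R : realType) d (k : 'rV[int]_d) : 'rV[R]_d :=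
  map_mx intr k.

Definition periodic_fun (R : realType) d (f : 'rV[R]_d -> R[i]) : Prop :=
  forall (x : 'rV[R]_d) (k : 'rV[int]_d), f (x + rv_of_int R k) = f x.

Definition iter_partial (R : realType) d (s : seq 'I_d) (g : 'rV[R]_d -> R^o) :
    'rV[R]_d -> R^o :=
  foldr (fun j (h : 'rV[R]_d -> R^o) x => 'D_(delta_mx 0 j : 'rV[R]_d) h x) g s.

Definition smooth_real (R : realType) d (g : 'rV[R]_d -> R^o) : Prop :=
  forall (s : seq 'I_d) (x : 'rV[R]_d), differentiable (iter_partial s g) x.

Definition smooth (R : realType) d (f : 'rV[R]_d -> R[i]) : Prop :=
  smooth_real (fun x => complex.Re (f x)) /\ smooth_real (fun x => complex.Im (f x)).

Section torus_measure.
Context (R : realType).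

Definition tcons d (x : measurableTypeR R * d.-tuple (measurableTypeR R)) :
    d.+1.-tuple (measurableTypeR R) :=
  [the d.+1.-tuple (measurableTypeR R) of x.1 :: x.2].

Lemma measurable_tcons d : measurable_fun setT (@tcons d).
Proof. exact: measurable_cons. Qed.

HB.instance Definition _ d :=
  isMeasurableFun.Build _ _ _ _ (@tcons d) (@measurable_tcons d).

(* The normalized Lebesgue measure of T^d: the d-fold product of the Lebesgue
   measure on the fundamental domain [0, 1]. *)
Fixpoint torus_measure (d : nat) : probability (d.-tuple (measurableTypeR R)) R :=
  match d return probability (d.-tuple (measurableTypeR R)) R with
  | 0 => dirac [tuple]
  | d'.+1 => distribution (uniform_prob (@ltr01 R) \x torus_measure d')%E
               (@tcons d')
  end.

End torus_measure.

Definition torus_integral (R : realType) d (f : 'rV[R]_d -> R[i]) : R[i] :=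
  (\int[torus_measure R d]_x complex.Re (f (rv_of_tuple x))) +i*
  (\int[torus_measure R d]_x complex.Im (f (rv_of_tuple x))).

Definition almost_all_torus (R : realType) d (P : 'rV[R]_d -> Prop) : Prop :=
  {ae torus_measure R d, forall rho, P (rv_of_tuple rho)}.

Definition e2pi (R : realType) (t : R) : R[i] :=
  cos (2 * pi * t) +i* sin (2 * pi * t).

Definition fourier_coef (R : realType) d (f : 'rV[R]_d -> R[i])
    (k : 'rV[int]_d) : R[i] :=
  torus_integral (fun x => f x * e2pi (- \sum_(j < d) (k 0 j)%:~R * x 0 j)).

(* The norm |k| of k in Z^d is the restriction of a norm of R^d (an abstract
   norm of the group Z^d need not have finite balls). *)
Definition is_norm (R : realType) d (nrm : 'rV[R]_d -> R) : Prop :=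
  [/\ forall x, 0 <= nrm x,
      forall x, nrm x = 0 -> x = 0,
      forall a x, nrm (a *: x) = `|a| * nrm x &
      forall x y, nrm (x + y) <= nrm x + nrm y].

Definition super_analytic (R : realType) d (nrm : 'rV[R]_d -> R)
    (f : 'rV[R]_d -> R[i]) : Prop :=
  forall v : R, 1 < v ->
  exists C M : R, forall k : 'rV[int]_d, M <= nrm (rv_of_int R k) ->
    normc (fourier_coef f k) <= C * expR (- (nrm (rv_of_int R k) `^ v)).

Definition weight_bump (R : realType) (p q x : R) : R :=
  expR (- (x `^ (- p) * (1 - x) `^ (- q))).

Definition weight (R : realType) (p q x : R) : R :=
  if 0 < x < 1 then
    (\int[lebesgue_measure]_(s in `]0, 1[) weight_bump p q s)^-1 *
    weight_bump p q x
  else 0.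

Definition weight_sum (R : realType) (p q : R) (N : nat) : R :=
  \sum_(n < N) weight p q (n%:R / N%:R).

Definition rotation (R : realType) d (rho theta : 'rV[R]_d) : 'rV[R]_d :=
  \row_j (theta 0 j + rho 0 j - (Num.floor (theta 0 j + rho 0 j))%:~R).

Definition birkhoff_error (R : realType) d (p q : R) (f : 'rV[R]_d -> R[i])
    (rho theta : 'rV[R]_d) (N : nat) : R :=
  normc (((weight_sum p q N)^-1)%:C *
           (\sum_(n < N) (weight p q (n%:R / N%:R))%:C *
                         f (iter n (rotation rho) theta))
         - torus_integral f).

(* Main.v *)
Require Import Defs.
From mathcomp Require Import all_boot all_order all_algebra.
From mathcomp Require Import all_classical all_reals all_analysis.
From mathcomp Require Import complex.
From mathcomp Require Import measurable_realfun ring lra zify.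
Import Order.TTheory GRing.Theory Num.Theory.
Import numFieldNormedType.Exports.
Import Normc.
Local Open Scope classical_set_scope.
Local Open Scope complex_scope.
Local Open Scope ring_scope.

Set Implicit Arguments.
Unset Strict Implicit.
Unset Printing Implicit Defensive.

(* Expanding f in Fourier series reduces the error to the sum over k <> 0 of
   |f^_k| |S_N(k.rho)| / A_N, where S_N(t) = sum_n w(n/N) e^(2 i pi n t).

   - Window.  Multiplying S_N(t) by (1 - e^(2 i pi t))^L replaces w by its L-th
     finite difference of step 1/N, so |S_N(t)| is at most about
     N (sup |w^(L)|^(1/L) / (N |1 - e^(2 i pi t)|))^L.  As w is of Gevrey class
     1 + 1/m with m = min(p, q), i.e. |w^(L)| <= (B L^(1 + 1/m))^L, the choice
     L ~ N^a gives O(exp(-N^a)) as soon as |1 - e^(2 i pi t)| >= g N^(-eps) with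
     a (1 + 1/m) + eps < 1.
   - Small divisors.  For almost all rho, |1 - e^(2 i pi k.rho)| >= g / W(k)^2
     for all k <> 0, where W(k) = prod_j (1 + |k_j|).
   - Cutoff.  As |f^_k| = O(exp(-c W(k)^v)) for every v, the frequencies with
     c W(k)^v >= 2 N^a are harmless, while for the others W(k)^2 = O(N^(2a/v))
     is as small a power of N as desired.

   The Fourier series is handled through the Fejer-type sums of f for the
   kernel c_K prod_j cos(pi t_j)^(2K), whose Fourier coefficients lie in
   [0, 1]: they converge pointwise to f by a Korovkin argument.  The powers
   cos(pi k.rho)^(2K) also majorize the indicators of the resonant sets, whose
   measure is thus bounded through the orthogonality of characters alone. *)

(** * Gevrey bound for the window *)

(** The order of the limits shapes the argument: N is fixed before K. For one N only finitely many
    orbit points occur, so pointwise convergence of the Fejer-type sums is applied at these points,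
    and a bound on finite frequency sums that is uniform in K passes to the limit. The product
    weight W(k) replaces |k| because the sum of W(k)^-2 over a box factors into one-dimensional sums
    and is at most 4^d for every box. This single estimate bounds both the measure of the resonant
    sets and the final sum over frequencies. Comparing |k| with W(k)^(1/d) multiplies the exponent
    of decay by d, which is harmless since every exponent is available. The parameters depend on a
    alone: 1/m and eps each take at most a quarter of the room 1 - a, and the decay exponent of the
    coefficients in W(k) is 8 / (1 - a). The decay of a coefficient is spent in two halves, one for
    summability and one for the cutoff, and the window bound is first obtained with exp (- 2 N^a).
    Hence the final rate has constant 1. *)

Section modulus.
Context {R : realType}.

Lemma normc_ge0 (z : R[i]) : 0 <= normc z.
Proof. by case: z => a b; rewrite /normc sqrtr_ge0. Qed.

Lemma normc_real (a : R) : normc a%:C = `|a|.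
Proof. by rewrite /normc /= expr0n addr0 sqrtr_sqr. Qed.

Lemma normcX (z : R[i]) n : normc (z ^+ n) = normc z ^+ n.
Proof. by elim: n => [|n IH]; rewrite ?expr0 ?normc1// !exprS normcM IH. Qed.

Lemma normc_sum (I : Type) (s : seq I) (P : pred I) (F : I -> R[i]) :
  normc (\sum_(i <- s | P i) F i) <= \sum_(i <- s | P i) normc (F i).
Proof.
elim/big_ind2 : _ => [|u a v b ua vb|//]; first by rewrite normc0.
by apply: le_trans (le_normcD _ _) _; exact: lerD.
Qed.

Lemma normc_le_ReIm (z : R[i]) : normc z <= `|complex.Re z| + `|complex.Im z|.
Proof.
case: z => a b /=; rewrite -[leRHS]ger0_norm ?addr_ge0// -sqrtr_sqr.
rewrite /normc ler_wsqrtr// sqrrD -[a ^+ 2]real_normK ?num_real//.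
rewrite -[b ^+ 2]real_normK ?num_real// lerD2r lerDl mulrn_wge0// mulr_ge0//.
Qed.

End modulus.

(** Raise exp (t / j) >= t / j to the power j. This flattens the bump at the endpoints, absorbs
    factors N and makes the coefficients summable. *)
Lemma exprn_le_expR (R : realType) (t : R) (j : nat) : (0 < j)%N -> 0 <= t ->
  t ^+ j <= j%:R ^+ j * expR t.
Proof.
move=> j0 t0.
have jR : 0 < j%:R :> R by rewrite ltr0n.
have -> : expR t = expR (t / j%:R) ^+ j.
  by rewrite -expRM_natl; congr expR; field; rewrite gt_eqF.
rewrite -exprMn lerXn2r ?nnegrE ?mulr_ge0 ?expR_ge0//.
rewrite mulrC -ler_pdivrMr//; apply: le_trans (expR_ge1Dx _); lra.
Qed.

(** * Derivatives of the bump inside the unit interval *)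

Section bump.
Context {R : realType}.
Variables p q : R.

(* On ]0, 1[, [bump_phi] is x^-p (1-x)^-q and [bump_term s r] is
   x^-s (1-x)^-r exp (- x^-p (1-x)^-q); the span of the latter is stable under
   differentiation, and [bump_derive n s r] is the n-th derivative of
   [bump_term s r]. *)
Definition bump_phi (x : R) : R := expR (- (p * ln x) - q * ln (1 - x)).

Definition bump_term (s r x : R) : R :=
  expR (- (s * ln x) - r * ln (1 - x) - bump_phi x).

Fixpoint bump_derive (n : nat) (s r x : R) : R :=
  if n is n'.+1 then
    - (s * bump_derive n' (s + 1) r x) + r * bump_derive n' s (r + 1) x
    + p * bump_derive n' (s + p + 1) (r + q) x
    - q * bump_derive n' (s + p) (r + q + 1) x
  else bump_term s r x.

Lemma bump_termD s r s' r' x :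
  bump_term (s + s') (r + r') x =
  bump_term s r x * expR (- (s' * ln x) - r' * ln (1 - x)).
Proof. by rewrite /bump_term -expRD; congr expR; ring. Qed.

Lemma is_derive_ln_onem (x : R) : x < 1 ->
  is_derive x 1 (fun y => ln (1 - y)) (- (1 - x)^-1).
Proof.
move=> x1; have h : 0 < 1 - x by lra.
have d1 : is_derive x 1 (fun y : R => 1 - y) (-1).
  have -> : (fun y : R => 1 - y) = cst 1 - id by apply/funext.
  by apply: is_derive_eq; rewrite sub0r.
have := @is_derive1_comp _ (@ln R) (fun y => 1 - y) x _ _ (is_derive1_ln h) d1.
by rewrite mulrN1.
Qed.

Lemma is_derive_bump_term (s r x : R) : 0 < x < 1 ->
  is_derive x 1 (bump_term s r) (bump_derive 1 s r x).
Proof.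
move=> /andP[x0 x1].
have dl : is_derive x 1 (@ln R) x^-1 := is_derive1_ln x0.
have dm := is_derive_ln_onem x1.
have lin (a b : R) : is_derive x 1 (fun y => - (a * ln y) - b * ln (1 - y))
    (- (a * x^-1) - b * - (1 - x)^-1).
  have -> : (fun y => - (a * ln y) - b * ln (1 - y)) =
     - (a \*: (@ln R : R -> R^o)) - (b \*: (fun y : R => (ln (1 - y) : R^o))) by apply/funext.
  by apply: is_derive_eq.
have dphi : is_derive x 1 bump_phi
    (bump_phi x * (- (p * x^-1) - q * - (1 - x)^-1)).
  have := @is_derive1_comp _ (@expR R) _ x _ _ (is_derive_expR _) (lin p q).
  exact.
have de : is_derive x 1 (fun y => - (s * ln y) - r * ln (1 - y) - bump_phi y)
   ((- (s * x^-1) - r * - (1 - x)^-1) -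
    (bump_phi x * (- (p * x^-1) - q * - (1 - x)^-1))).
  have -> : (fun y => - (s * ln y) - r * ln (1 - y) - bump_phi y) =
     (fun y => - (s * ln y) - r * ln (1 - y)) - bump_phi by apply/funext.
  by apply: is_derive_eq.
have := @is_derive1_comp _ (@expR R) _ x _ _ (is_derive_expR _) de.
rewrite -[_ \o _]/(bump_term s r); congr is_derive.
have h : 0 < 1 - x by lra.
(* The inverses become exponentials of - ln x and - ln (1 - x), so that both sides are polynomials
   in common exponentials. *)
rewrite /= /bump_term -[x^-1]lnK ?posrE ?invr_gt0// -[(1 - x)^-1]lnK ?posrE ?invr_gt0//.
rewrite !lnV ?posrE//.
set u := ln x; set v := ln (1 - x).
set P := bump_phi x.
have eP : P = expR (- (p * u)) * expR (- (q * v)) by rewrite -expRD.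
rewrite (_ : - ((s + 1) * u) - r * v - P = (- (s * u) - r * v - P) + - u); last by ring.
rewrite (_ : - (s * u) - (r + 1) * v - P = (- (s * u) - r * v - P) + - v); last by ring.
rewrite (_ : - ((s + p + 1) * u) - (r + q) * v - P = (- (s * u) - r * v - P) + (- (p * u) - q * v) + - u); last by ring.
rewrite (_ : - ((s + p) * u) - (r + q + 1) * v - P = (- (s * u) - r * v - P) + (- (p * u) - q * v) + - v); last by ring.
rewrite !expRD; move: (expR (- P)) => E; rewrite eP; ring.
Qed.

Lemma is_derive_bump_derive n (s r x : R) : 0 < x < 1 ->
  is_derive x 1 (bump_derive n s r) (bump_derive n.+1 s r x).
Proof.
move=> x01; elim: n s r => [|n IH] s r; first exact: is_derive_bump_term.
have -> : bump_derive n.+1 s r =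
  - (s \*: (bump_derive n (s + 1) r : R -> R^o)) +
    r \*: (bump_derive n s (r + 1) : R -> R^o) +
    p \*: (bump_derive n (s + p + 1) (r + q) : R -> R^o) -
    q \*: (bump_derive n (s + p) (r + q + 1) : R -> R^o) by apply/funext.
by apply: is_derive_eq.
Qed.

(** Each derivative costs a factor at most Y = 1 / (x (1 - x)) and raises s + r by at most p + q +
    1; its four coefficients add up to s + r + (p + q) phi, where phi appears when the derivative
    falls on [bump_phi]. With s and r free in the induction, the increments accumulate in the last
    factor. *)
Lemma bump_derive_bound n (s r x : R) : 0 < x < 1 -> 0 <= p -> 0 <= q ->
  0 <= s -> 0 <= r ->
  `|bump_derive n s r x| <=
  bump_term s r x * (x * (1 - x))^-1 ^+ n *
  (s + r + (p + q + 1) * (n%:R + bump_phi x)) ^+ n.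
Proof.
move=> /andP[x0 x1] p0 q0.
have h : 0 < 1 - x by lra.
set Y := (x * (1 - x))^-1; set A := p + q + 1; set P := bump_phi x.
have P0 : 0 <= P by rewrite expR_ge0.
have Y0 : 0 <= Y by rewrite invr_ge0 mulr_ge0// ltW.
have EY : expR (- ln x - ln (1 - x)) = Y.
  rewrite /Y invfM expRD !expRN !lnK ?posrE//.
have Eu : expR (- ln x) <= Y.
  by rewrite -EY ler_expR lerDl oppr_ge0 ln_le0//; lra.
have Ev : expR (- ln (1 - x)) <= Y.
  by rewrite -EY ler_expR lerDr oppr_ge0 ln_le0//; lra.
elim: n s r => [|n IH] s r s0 r0.
  by rewrite /= !expr0 !mulr1 ger0_norm ?expR_ge0.
(* [T] treats the four terms of the recursion uniformly: t is 1 when only s or r is raised by one,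
   and phi when p and q are added as well. *)
have T s' r' t : 0 <= s' -> 0 <= r' -> s' + r' <= s + r + A -> 0 <= t ->
    bump_term s' r' x <= bump_term s r x * t * Y ->
    `|bump_derive n s' r' x| <= bump_term s r x * t * Y ^+ n.+1 *
      (s + r + A * (n.+1%:R + P)) ^+ n.
  move=> s'0 r'0 sr' t0 H; apply: le_trans (IH _ _ s'0 r'0) _.
  have -> : bump_term s r x * t * Y ^+ n.+1 = (bump_term s r x * t * Y) * Y ^+ n.
    by rewrite exprS; ring.
  rewrite ler_pM ?mulr_ge0 ?exprn_ge0 ?expR_ge0 ?addr_ge0//; [|by rewrite ler_wpM2r ?exprn_ge0|].
    by rewrite mulr_ge0 // /A ?addr_ge0.
  rewrite lerXn2r ?nnegrE//.
  - by rewrite !addr_ge0// mulr_ge0 // /A ?addr_ge0.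
  - by rewrite !addr_ge0// mulr_ge0 // /A ?addr_ge0.
  - rewrite -natr1; nra.
set W := (s + r + A * (n.+1%:R + P)).
have W0 : 0 <= W by rewrite !addr_ge0// mulr_ge0 // /A ?addr_ge0.
have b0 a b : 0 <= bump_term a b x by exact: expR_ge0.
have H1 : `|bump_derive n (s + 1) r x| <= bump_term s r x * 1 * Y ^+ n.+1 * W ^+ n.
  apply: T => //; [lra| rewrite /A; lra |].
  rewrite -[r in bump_term _ r]addr0 bump_termD mulr1 ler_wpM2l//.
  by rewrite mul1r mul0r subr0.
have H2 : `|bump_derive n s (r + 1) x| <= bump_term s r x * 1 * Y ^+ n.+1 * W ^+ n.
  apply: T => //; [lra| rewrite /A; lra |].
  rewrite -[s in bump_term s (r + 1)]addr0 bump_termD mulr1 ler_wpM2l//.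
  by rewrite mul1r mul0r oppr0 add0r.
have H3 : `|bump_derive n (s + p + 1) (r + q) x| <= bump_term s r x * P * Y ^+ n.+1 * W ^+ n.
  apply: T => //; [lra|lra| rewrite /A; lra |].
  rewrite -addrA bump_termD -mulrA ler_wpM2l//.
  rewrite (_ : _ - _ = (- (p * ln x) - q * ln (1 - x)) + - ln x); last by ring.
  by rewrite expRD ler_wpM2l.
have H4 : `|bump_derive n (s + p) (r + q + 1) x| <= bump_term s r x * P * Y ^+ n.+1 * W ^+ n.
  apply: T => //; [lra|lra| rewrite /A; lra |].
  rewrite -[r + q + 1]addrA bump_termD -mulrA ler_wpM2l//.
  rewrite (_ : _ - _ = (- (p * ln x) - q * ln (1 - x)) + - ln (1 - x)); last by ring.
  by rewrite expRD ler_wpM2l.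
rewrite /= -/bump_derive.
apply: le_trans (ler_normB _ _) _; apply: le_trans (lerD (ler_normD _ _) (lexx _)) _.
apply: le_trans (lerD (lerD (ler_normD _ _) (lexx _)) (lexx _)) _.
rewrite normrN !normrM (ger0_norm s0) (ger0_norm r0) (ger0_norm p0) (ger0_norm q0).
set Z := bump_term s r x * Y ^+ n.+1 * W ^+ n.
have Z0 : 0 <= Z by rewrite !mulr_ge0 ?exprn_ge0.
apply: (@le_trans _ _ ((s + r + (p + q) * P) * Z)).
  have -> : (s + r + (p + q) * P) * Z = s * (bump_term s r x * 1 * Y ^+ n.+1 * W ^+ n) +
    r * (bump_term s r x * 1 * Y ^+ n.+1 * W ^+ n) + p * (bump_term s r x * P * Y ^+ n.+1 * W ^+ n)
    + q * (bump_term s r x * P * Y ^+ n.+1 * W ^+ n) by rewrite /Z; ring.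
  by rewrite !lerD// ler_wpM2l.
have -> : bump_term s r x * Y ^+ n.+1 * W ^+ n.+1 = W * Z by rewrite /Z [W ^+ n.+1]exprS; ring.
rewrite ler_wpM2r// /W /A -natr1.
have n0 : 0 <= n%:R :> R by [].
nra.
Qed.

End bump.

(** The bound forces f a = 0 and makes the difference quotient O(h). It glues the derivatives inside
    ]0, 1[ to the zero function outside. *)
Lemma is_derive_flat (R : realType) (f : R -> R) (a C : R) :
  (forall y, `|f y| <= C * (y - a) ^+ 2) -> is_derive a (1 : R) f 0.
Proof.
move=> H.
have C0 : 0 <= C.
  by have := le_trans (normr_ge0 _) (H (a + 1)); rewrite addrAC subrr add0r expr1n mulr1.
have fa : f a = 0.
  by apply/eqP; rewrite -normr_le0 (le_trans (H a))// subrr expr0n mulr0.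
have cv : (fun h : R => h^-1 *: ((f \o shift a) (h *: (1 : R)) - f a)) @ 0^' --> (0 : R).
  apply/cvgr0Pnorm_le => e e0.
  near=> h.
  rewrite /= fa subr0 normrM normfV.
  have h0 : h != 0 by near: h; exact: nbhs_dnbhs_neq.
  have hp : 0 < `|h| by rewrite normr_gt0.
  rewrite mulrC ler_pdivrMr//.
  apply: le_trans (H _) _; rewrite addrK [_ *: _]mulr1.
  have hC : (C + 1) * `|h| <= e.
    rewrite mulrC -ler_pdivlMr; last by lra.
    near: h; apply: dnbhs0_le; apply: divr_gt0 => //; lra.
  rewrite -[h ^+ 2]real_normK ?num_real//.
  nra.
have cv' : derivable f a (1 : R) by apply/cvg_ex; exists 0.
by apply: DeriveDef => //; apply: cvg_lim.
Unshelve. all: by end_near.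
Qed.

(** * Finite differences and summation by parts *)

Section finite_differences.
Context {R : realType}.
Implicit Types (f : R -> R) (h x : R) (L : nat).

Definition bdiff h f x := f x - f (x - h).

Lemma bdiff_iterS h L f : iter L.+1 (bdiff h) f = iter L (bdiff h) (bdiff h f).
Proof. by rewrite iterSr. Qed.

(** [F] lists a function and its successive derivatives. Applying [bdiff h] to each member gives
    another such list, whose member of order L is at most h * M by the mean value theorem when M
    bounds the member of order L + 1 of [F]; this closes the induction. *)
Lemma bdiff_le (F : nat -> R -> R) h L M : 0 <= h ->
  (forall n x, is_derive x (1 : R) (F n) (F n.+1 x)) ->
  (forall x, `|F L x| <= M) ->
  forall x, `|iter L (bdiff h) (F 0) x| <= h ^+ L * M.
Proof.
move=> h0; elim: L F M => [|L IH] F M dF FM x.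
  by rewrite expr0 mul1r; exact: FM.
rewrite bdiff_iterS.
have dsh n y : is_derive y (1 : R) (fun z => F n (z - h)) (F n.+1 (y - h)).
  have di : is_derive y (1 : R) (fun z : R => z - h) 1.
    have -> : (fun z : R => z - h) = id - cst h by apply/funext.
    by apply: is_derive_eq; rewrite subr0.
  have := @is_derive1_comp _ (F n) (fun z => z - h) y _ _ (dF n (y - h)) di.
  by rewrite mulr1.
have dG n y : is_derive y (1 : R) (bdiff h (F n)) (bdiff h (F n.+1) y).
  have -> : bdiff h (F n) = F n - (fun z => F n (z - h)) by apply/funext.
  by apply: is_derive_eq.
rewrite exprSr -mulrA.
apply: (IH (fun n => bdiff h (F n)) (h * M) dG) => y.
rewrite /bdiff.
have yh : y - h <= y by lra.
have cL : {within `[y - h, y], continuous (F L)}.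
  apply: derivable_within_continuous => z _.
  exact: (@ex_derive _ _ _ _ _ _ _ (dF L z)).
have [c _ ->] := MVT_segment yh (fun z _ => dF L z) cL.
rewrite opprB addrC subrK normrM (ger0_norm h0) mulrC.
by rewrite ler_wpM2l.
Qed.

Lemma bdiff_le0 h L f : 0 <= h -> (forall x, x <= 0 -> f x = 0) ->
  forall x, x <= 0 -> iter L (bdiff h) f x = 0.
Proof.
move=> h0 f0; elim: L => [|L IH] x x0; first exact: f0.
by rewrite iterS /bdiff !IH ?subrr//; lra.
Qed.

Lemma bdiff_ge1 h L f : 0 <= h -> (forall x, 1 <= x -> f x = 0) ->
  forall x, 1 + L%:R * h <= x -> iter L (bdiff h) f x = 0.
Proof.
move=> h0 f0; elim: L => [|L IH] x; first by rewrite mul0r addr0; exact: f0.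
rewrite -natr1 mulrDl mul1r => x0.
by rewrite iterS /bdiff !IH ?subrr//; lra.
Qed.

(** After a shift of index, the two boundary terms are f (M h) and f (- h), and both vanish. *)
Lemma summation_by_parts f h (M : nat) (z : R[i]) :
  (forall x, x <= 0 -> f x = 0) -> 0 <= h -> (forall x, M%:R * h <= x -> f x = 0) ->
  (1 - z) * (\sum_(n < M.+1) (f (n%:R * h))%:C * z ^+ n) =
  \sum_(n < M.+1) (bdiff h f (n%:R * h))%:C * z ^+ n.
Proof.
move=> f0 h0 fM.
rewrite mulrBl mul1r.
under [RHS]eq_bigr do rewrite /bdiff rmorphB mulrBl.
rewrite big_split /= sumrN; congr (_ - _).
rewrite [in LHS]big_ord_recr /= fM// mul0r addr0.
rewrite [RHS]big_ord_recl /= mul0r f0 ?sub0r ?oppr_le0// mul0r add0r mulr_sumr.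
apply: eq_bigr => i _; rewrite /bump /= add1n exprS.
rewrite (_ : i.+1%:R * h - h = i%:R * h); last by rewrite -natr1; ring.
by rewrite mulrCA.
Qed.

Lemma iter_summation_by_parts f (N L : nat) (z : R[i]) : (0 < N)%N ->
  (forall x, x <= 0 -> f x = 0) -> (forall x, 1 <= x -> f x = 0) ->
  (1 - z) ^+ L * (\sum_(n < N) (f (n%:R / N%:R))%:C * z ^+ n) =
  \sum_(n < (N + L).+1)
    (iter L (bdiff N%:R^-1) f (n%:R / N%:R))%:C * z ^+ n.
Proof.
move=> N0 f0 f1.
have NR : 0 < N%:R :> R by rewrite ltr0n.
have h0 : 0 <= N%:R^-1 :> R by rewrite invr_ge0 ltW.
have -> : \sum_(n < N) (f (n%:R / N%:R))%:C * z ^+ n =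
    \sum_(n < (N + L).+1) (f (n%:R / N%:R))%:C * z ^+ n.
  rewrite -!(big_mkord xpredT (fun n => (f (n%:R / N%:R))%:C * z ^+ n)).
  rewrite (big_cat_nat _ (n := N) (p := (N + L).+1))//=; last by rewrite ltnW// ltnS leq_addr.
  rewrite [X in _ = _ + X]big_nat_cond [X in _ = _ + X]big1 ?addr0// => i /andP[/andP[Ni _] _].
  by rewrite f1 ?mul0r// ler_pdivlMr// mul1r ler_nat.
(* Each difference widens the support by 1 / N. The range of summation is fixed at some K >= N + L,
   and the induction on L keeps the same K. *)
suff gen K : (N + L <= K)%N -> (1 - z) ^+ L *
    (\sum_(n < K.+1) (f (n%:R / N%:R))%:C * z ^+ n) =
    \sum_(n < K.+1) (iter L (bdiff N%:R^-1) f (n%:R / N%:R))%:C * z ^+ n.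
  exact: gen.
elim: L => [|L IH] H; first by rewrite expr0 mul1r.
rewrite exprS -mulrA IH; last by lia.
apply: summation_by_parts => //.
  by move=> x x0; exact: bdiff_le0.
move=> x Kx; apply: bdiff_ge1 => //; apply: le_trans Kx.
have -> : 1 + L%:R * N%:R^-1 = (N + L)%:R / N%:R :> R.
  by rewrite natrD mulrDl divff ?gt_eqF.
by rewrite ler_wpM2r// ler_nat; lia.
Qed.

End finite_differences.

(** * The bump extended by zero to the whole line *)

Section bump_extension.
Context {R : realType}.
Variables p q m : R.
Hypotheses (m1 : 1 <= m) (mp : m <= p) (mq : m <= q).

Let p0 : 0 <= p. Proof. exact: le_trans (le_trans ler01 m1) mp. Qed.
Let q0 : 0 <= q. Proof. exact: le_trans (le_trans ler01 m1) mq. Qed.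

Let bump_phi_ge1 x : 0 < x < 1 -> 1 <= bump_phi p q x.
Proof.
move=> /andP[x0 x1]; rewrite -expR0 ler_expR.
have u0 : ln x <= 0 by apply: ln_le0; lra.
have v0 : ln (1 - x) <= 0 by apply: ln_le0; lra.
by rewrite subr_ge0 (le_trans (mulr_ge0_le0 q0 v0))// oppr_ge0 mulr_ge0_le0.
Qed.

(** As p and q are at least m, phi = x^-p (1 - x)^-q dominates (x (1 - x))^-m. This is the origin of
    1/m in the Gevrey exponent: the factor Y^n in the derivative bound costs only phi^(n/m). *)
Let inv_le_phi x : 0 < x < 1 -> (x * (1 - x))^-1 <= bump_phi p q x `^ m^-1.
Proof.
move: (m1) (mp) (mq) (p0) (q0) => m1' mp' mq' p0' q0'.
move=> /andP[x0 x1]; have h : 0 < 1 - x by lra.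
rewrite /powR expR_eq0 expRK.
rewrite -[leLHS]lnK ?posrE ?invr_gt0 ?mulr_gt0// ler_expR lnV ?posrE ?mulr_gt0//.
rewrite lnM ?posrE// mulrC ler_pdivlMr; last by lra.
have u0 : ln x <= 0 by apply: ln_le0; lra.
have v0 : ln (1 - x) <= 0 by apply: ln_le0; lra.
have pu : p * ln x <= m * ln x by rewrite ler_wnM2r.
have qv : q * ln (1 - x) <= m * ln (1 - x) by rewrite ler_wnM2r.
lra.
Qed.

Let inv_le_phi1 x : 0 < x < 1 -> (x * (1 - x))^-1 <= bump_phi p q x.
Proof.
move: (m1) (mp) (mq) (p0) (q0) => m1' mp' mq' p0' q0'.
move=> x01; apply: le_trans (inv_le_phi x01) _.
apply: ler1_powR; first exact: bump_phi_ge1.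
by rewrite invf_le1//; lra.
Qed.

Definition bump_ext n x := if 0 < x < 1 then bump_derive p q n 0 0 x else 0.

Let bump_term00 x : bump_term p q 0 0 x = expR (- bump_phi p q x).
Proof. by rewrite /bump_term; congr expR; ring. Qed.

(** With Y <= phi, the derivative bound is at most a constant times phi^(2 n) exp (- phi). Two more
    powers of phi pay for the factor (x (1 - x))^2, and exp (- phi) dominates them all. *)
Lemma bump_ext_flat n : exists C, forall x, 0 < x < 1 ->
  `|bump_ext n x| <= C * (x * (1 - x)) ^+ 2.
Proof.
move: (m1) (mp) (mq) (p0) (q0) => m1' mp' mq' p0' q0'.
pose A := p + q + 1.
exists ((A * (n%:R + 1)) ^+ n * (n + n + 2)%:R ^+ (n + n + 2)) => x x01.
rewrite /bump_ext x01.
have := bump_derive_bound n x01 p0 q0 (lexx _) (lexx _).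
rewrite bump_term00 !add0r -/A.
have := bump_phi_ge1 x01; have := inv_le_phi1 x01.
set P := bump_phi p q x; set Y := (_ * _)^-1 => YP P1 H.
have Y0 : 0 < Y by rewrite invr_gt0; nra.
have -> : x * (1 - x) = Y^-1 by rewrite invrK.
rewrite exprVn ler_pdivlMr ?exprn_gt0//.
have n0 : 0 <= n%:R :> R by [].
have A0 : 0 <= A by rewrite /A; lra.
apply: (@le_trans _ _ (expR (- P) * P ^+ n * (A * (n%:R + 1) * P) ^+ n * P ^+ 2)).
  have Y2P2 : Y ^+ 2 <= P ^+ 2 by rewrite lerXn2r ?nnegrE//; lra.
  rewrite ler_pM ?exprn_ge0// ?(ltW Y0)//.
  apply: le_trans H _.
  rewrite ler_pM ?mulr_ge0 ?exprn_ge0 ?expR_ge0 ?mulr_ge0 ?addr_ge0//; try lra.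
    by rewrite ler_wpM2l ?expR_ge0// lerXn2r ?nnegrE//; lra.
  rewrite lerXn2r ?nnegrE ?mulr_ge0//; try lra; try nra.
  rewrite -mulrA ler_wpM2l//; nra.
have PE : P ^+ (n + n + 2) <= (n + n + 2)%:R ^+ (n + n + 2) * expR P.
  by apply: exprn_le_expR; [rewrite addnS|lra].
have -> : expR (- P) * P ^+ n * (A * (n%:R + 1) * P) ^+ n * P ^+ 2 =
   (A * (n%:R + 1)) ^+ n * (P ^+ (n + n + 2) * expR (- P)).
  by rewrite !exprD exprMn; ring.
rewrite ler_wpM2l//; first by rewrite exprn_ge0// mulr_ge0//; lra.
by rewrite expRN ler_pdivrMr ?expR_gt0.
Qed.

Lemma is_derive_bump_ext n (x : R) : is_derive x (1 : R) (bump_ext n) (bump_ext n.+1 x).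
Proof.
have [C HC] := bump_ext_flat n.
have C0 : 0 <= C.
  have h : 0 < (2^-1 : R) < 1 by lra.
  have h2 : 0 < (2^-1 * (1 - 2^-1)) ^+ 2 :> R by rewrite exprn_gt0//; lra.
  by have := le_trans (normr_ge0 _) (HC _ h); rewrite pmulr_lge0.
have [x01|nx01] := boolP (0 < x < 1).
  rewrite /(bump_ext n.+1) x01.
  apply: (near_eq_is_derive _ (is_derive_bump_derive p q n 0 0 x01)).
  move/andP: x01 => [x0 x1].
  near=> y; rewrite /bump_ext (_ : 0 < y < 1)//.
  by apply/andP; split; near: y; [exact: lt_nbhsr | exact: lt_nbhsl].
rewrite [bump_ext n.+1 x]ifN//.
(* For y in ]0, 1[ and any x outside, y (1 - y) <= |y - x|; the flatness bound is thus quadratic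
   about every such x, endpoint or not. *)
apply: (@is_derive_flat _ _ _ C) => y.
have [y01|ny] := boolP (0 < y < 1); last first.
  by rewrite /bump_ext ifN// normr0 mulr_ge0// sqr_ge0.
apply: le_trans (HC _ y01) _; rewrite ler_wpM2l//.
move: nx01 y01; rewrite negb_and -!leNgt => nx /andP[y0 y1].
have h : 0 <= y * (1 - y) by nra.
have [x0|x1] := orP nx; last rewrite -[in leRHS]sqrrN; rewrite lerXn2r ?nnegrE//; nra.
Unshelve. all: by end_near.
Qed.

(** The powers (n + phi)^n and phi^(n/m) are each traded for exp (phi / 4), at the price of (4 n)^n
    and (4 n)^(n/m). The choice k = 4 n makes the n-th power of exp (phi / k) equal to exp (phi /
    4), and half of exp (- phi) is left over. *)
Lemma bump_ext_gevrey n x : (0 < n)%N ->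
  `|bump_ext n x| <= ((p + q + 1) * (4 * n%:R) `^ (1 + m^-1)) ^+ n.
Proof.
move: (m1) (mp) (mq) (p0) (q0) => m1' mp' mq' p0' q0'.
move=> n0; have nR : 0 < n%:R :> R by rewrite ltr0n.
pose A := p + q + 1; have A0 : 0 <= A by rewrite /A; lra.
have [x01|nx] := boolP (0 < x < 1); last first.
  by rewrite /bump_ext ifN// normr0 exprn_ge0// mulr_ge0// powR_ge0.
rewrite /bump_ext x01.
have := bump_derive_bound n x01 p0 q0 (lexx _) (lexx _).
rewrite bump_term00 !add0r -/A.
have := bump_phi_ge1 x01; have := inv_le_phi x01.
set P := bump_phi p q x; set Y := (_ * _)^-1 => YP P1 H.
have Y0 : 0 < Y by rewrite invr_gt0; move/andP: x01 => [? ?]; nra.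
apply: le_trans H _.
pose k := 4 * n%:R : R; have k0 : 0 < k by rewrite /k; lra.
pose E := expR (P / k).
have E1 : 1 + P / k <= E by exact: expR_ge1Dx.
have Pk : 0 <= P / k by rewrite divr_ge0//; lra.
have E4 : E ^+ n = expR (P / 4).
  by rewrite /E -expRM_natl; congr expR; rewrite /k; field; lra.
have h1 : (A * (n%:R + P)) ^+ n <= (A * k) ^+ n * expR (P / 4).
  rewrite -E4 -exprMn lerXn2r ?nnegrE ?mulr_ge0//; try lra.
  rewrite -mulrA ler_wpM2l//.
  have : k * (1 + P / k) <= k * E by rewrite ler_pM2l.
  by rewrite mulrDr mulrCA divff ?gt_eqF// !mulr1; move=> ?; rewrite (_ : n%:R = k / 4)//; [lra|rewrite /k; field].
have h2 : Y ^+ n <= (k `^ m^-1) ^+ n * expR (P / 4).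
  apply: le_trans (_ : (P `^ m^-1) ^+ n <= _); first by rewrite lerXn2r ?nnegrE ?powR_ge0// ltW.
  have Em : E `^ m^-1 <= E.
    by apply: ler1_powR; [lra|rewrite invf_le1//; lra].
  rewrite -E4 -exprMn lerXn2r ?nnegrE ?mulr_ge0 ?powR_ge0 ?expR_ge0//.
  apply: le_trans (_ : (k * E) `^ m^-1 <= _).
    apply: ge0_ler_powR; rewrite ?invr_ge0 ?nnegrE ?mulr_ge0 ?expR_ge0//; try lra.
    by rewrite mulrC -ler_pdivrMr//; lra.
  by rewrite powRM ?expR_ge0 ?(ltW k0)// ler_wpM2l ?powR_ge0.
rewrite -/k powRD; last by rewrite (gt_eqF k0) implybT.
rewrite powRr1 ?(ltW k0)// mulrA [leRHS]exprMn [leRHS]mulrC.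
apply: le_trans (_ : expR (- P) * ((k `^ m^-1) ^+ n * expR (P / 4)) * ((A * k) ^+ n * expR (P / 4)) <= _).
  rewrite ler_pM// ?mulr_ge0 ?exprn_ge0 ?expR_ge0//; try lra.
    by rewrite mulr_ge0//; lra.
  by rewrite ler_wpM2l ?expR_ge0.
have -> : forall a b c d e : R, a * (b * c) * (d * e) = b * d * (a * c * e) by move=> *; ring.
rewrite -!expRD -[leRHS]mulr1 ler_wpM2l//.
  by rewrite mulr_ge0 ?exprn_ge0 ?powR_ge0// mulr_ge0// ltW.
by rewrite expR_le1; lra.
Qed.

Lemma weight_bumpE x : 0 < x < 1 -> weight_bump p q x = bump_ext 0 x.
Proof.
move=> x01; rewrite /bump_ext x01 /= bump_term00 /weight_bump; congr (expR (- _)).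
move/andP: x01 => [x0 x1].
rewrite /bump_phi /powR !gt_eqF//; last by lra.
by rewrite -expRD; congr expR; ring.
Qed.

Definition bump_mass : R := \int[lebesgue_measure]_(s in `]0, 1[) weight_bump p q s.

Lemma weightE x : weight p q x = bump_mass^-1 * bump_ext 0 x.
Proof.
rewrite /weight; case: ifPn => [x01|nx01]; first by rewrite weight_bumpE.
by rewrite /bump_ext ifN ?mulr0.
Qed.

Lemma bump_ext0_le1 x : 0 <= bump_ext 0 x <= 1.
Proof.
rewrite /bump_ext; case: ifP => _; rewrite ?lexx ?ler01//=.
by rewrite bump_term00 expR_ge0 -expR0 ler_expR oppr_le0 expR_ge0.
Qed.

(** N + L + 1 counts the nodes kept for the L-th difference, which is at most N^-L times the Gevrey
    bound at each of them; dividing by |1 - z|^L gives the power. *)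
Lemma bump_exponential_sum (N L : nat) (z : R[i]) (eta : R) :
  (0 < N)%N -> (0 < L)%N -> normc z = 1 -> 0 < eta -> eta <= normc (1 - z) ->
  normc (\sum_(n < N) (bump_ext 0 (n%:R / N%:R))%:C * z ^+ n) <=
  (N + L).+1%:R * ((p + q + 1) * (4 * L%:R) `^ (1 + m^-1) / (N%:R * eta)) ^+ L.
Proof.
move: (m1) (mp) (mq) (p0) (q0) => m1' mp' mq' p0' q0'.
move=> N0 L0 z1 eta0 etaz.
have NR : 0 < N%:R :> R by rewrite ltr0n.
have b0 x : x <= 0 -> bump_ext 0 x = 0.
  by move=> x0; rewrite /bump_ext ifN// negb_and -!leNgt x0.
have b1 x : 1 <= x -> bump_ext 0 x = 0.
  by move=> x0; rewrite /bump_ext ifN// negb_and -!leNgt x0 orbT.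
have := iter_summation_by_parts L z N0 b0 b1.
move/(congr1 (@normc R)); rewrite normcM.
set S := normc (\sum_(n < N) _) => H.
set B := (p + q + 1) * _.
have HS : eta ^+ L * S <= (N + L).+1%:R * (N%:R^-1 ^+ L * B ^+ L).
  apply: (@le_trans _ _ (normc ((1 - z) ^+ L) * S)).
    rewrite ler_wpM2r//; first exact: normc_ge0.
    by rewrite normcX lerXn2r ?nnegrE// ltW// (lt_le_trans eta0).
  rewrite H.
  apply: le_trans (normc_sum _ _ _) _.
  apply: (@le_trans _ _ (\sum_(n < (N + L).+1) (N%:R^-1 ^+ L * B ^+ L))); last first.
    by rewrite sumr_const card_ord mulr_natl.
  apply: ler_sum => i _.
  rewrite normcM normcX z1 expr1n mulr1 normc_real.
  apply: (@bdiff_le _ bump_ext); first by rewrite invr_ge0 ltW.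
    exact: is_derive_bump_ext.
  by move=> x; exact: bump_ext_gevrey.
rewrite (_ : B / (N%:R * eta) = N%:R^-1 * B / eta); last by rewrite invfM; ring.
rewrite expr_div_n mulrA ler_pdivlMr ?exprn_gt0// mulrC.
by rewrite exprMn.
Qed.

End bump_extension.

(** * Normalization of the window *)

Section weight_normalization.
Context {R : realType}.
Variables p q m : R.
Hypotheses (m1 : 1 <= m) (mp : m <= p) (mq : m <= q).

Let p0 : 0 <= p. Proof. exact: le_trans (le_trans ler01 m1) mp. Qed.
Let q0 : 0 <= q. Proof. exact: le_trans (le_trans ler01 m1) mq. Qed.

(** This is exp (- 3^(p + q)), a lower bound for the bump on [1/3, 1/2], where x and 1 - x are at
    least 1/3. For every N >= 2 this interval contains a node n / N. *)
Definition bump_floor : R := expR (- expR ((p + q) * ln 3)).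

Lemma bump_floor_le x : 3^-1 <= x <= 2^-1 -> bump_floor <= bump_ext p q 0 x.
Proof.
move=> /andP[x3 x2].
rewrite /bump_ext (_ : 0 < x < 1); last by lra.
rewrite /= /bump_term /bump_floor /bump_phi ler_expR.
rewrite !mul0r !oppr0 !add0r lerN2 ler_expR.
have l3 (y : R) : 3^-1 <= y -> - ln y <= ln 3.
  move=> y3; rewrite lerNl -lnV ?posrE// ler_ln ?posrE//; lra.
have a1 : p * - ln x <= p * ln 3 by rewrite ler_wpM2l// l3.
have a2 : q * - ln (1 - x) <= q * ln 3 by rewrite ler_wpM2l// l3//; lra.
lra.
Qed.

(** The part of the integral over ]1/3, 1/2[ is already positive. The weight divides by this mass,
    so it must be nonzero to cancel in the averages. *)
Lemma bump_mass_gt0 : 0 < bump_mass p q.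
Proof.
have cb : continuous (bump_ext p q 0 : R -> R).
  move=> x; apply: differentiable_continuous; apply/derivable1_diffP.
  exact: (@ex_derive _ _ _ _ _ _ _ (is_derive_bump_ext m1 mp mq 0 x)).
have mb (D : set R) : measurable D -> measurable_fun D (bump_ext p q 0).
  by move=> mD; apply: measurable_funTS; exact: continuous_measurable_fun.
have -> : bump_mass p q = \int[lebesgue_measure]_(s in `]0, 1[) bump_ext p q 0 s.
  apply: eq_Rintegral => x; rewrite inE/= in_itv/= => x01.
  by rewrite (weight_bumpE p q x01).
pose J : set R := `]3^-1, 2^-1[%classic; pose K : set R := `]0, 1[%classic.
have mJ : measurable J by exact: measurable_itv.
have mK : measurable K by exact: measurable_itv.
rewrite /Rintegral -/K fine_gt0//; apply/andP; split.
  apply: (@lt_le_trans _ _ (\int[lebesgue_measure]_(s in J) (bump_floor)%:E)%E).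
    rewrite integral_cst//= /J lebesgue_measure_itv/= lte_fin ifT; last by lra.
    rewrite -EFinD -EFinM lte_fin mulr_gt0 ?expR_gt0//; lra.
  apply: (@le_trans _ _ (\int[lebesgue_measure]_(s in J) (bump_ext p q 0 s)%:E)%E).
    apply: ge0_le_integral => //.
    - by move=> x _; rewrite lee_fin expR_ge0.
    - by apply/measurable_EFinP; exact: mb.
    - move=> x; rewrite /J/= in_itv/= => /andP[x3 x2].
      by rewrite lee_fin bump_floor_le// !ltW.
  apply: ge0_subset_integral => //.
  - by apply/measurable_EFinP; exact: mb.
  - by move=> x _; rewrite lee_fin; have /andP[] := bump_ext0_le1 p q x.
  - by move=> x; rewrite /J /K/= !in_itv/= => /andP[a b]; lra.
(* Finiteness must be checked too, because [fine] sends an infinite integral to 0. *)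
apply: (@le_lt_trans _ _ (\int[lebesgue_measure]_(s in K) (1 : R)%:E)%E).
  apply: ge0_le_integral => //.
  - by move=> x _; rewrite lee_fin; have /andP[] := bump_ext0_le1 p q x.
  - by apply/measurable_EFinP; exact: mb.
  - by move=> x _; rewrite lee_fin; have /andP[] := bump_ext0_le1 p q x.
rewrite integral_cst//= /K lebesgue_measure_itv/= lte_fin ltr01.
by rewrite -EFinD -EFinM ltry.
Qed.

Definition bump_sum (N : nat) : R := \sum_(n < N) bump_ext p q 0 (n%:R / N%:R).

(** The node with n = N / 2 rounded down lies in [1/3, 1/2], and the other terms are nonnegative.
    The sum is really of order N; the factor N lost here is absorbed by the exponential decay. *)
Lemma bump_sum_ge (N : nat) : (1 < N)%N -> bump_floor <= bump_sum N.
Proof.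
move=> N1.
have hN : (N./2 < N)%N by lia.
rewrite /bump_sum (bigD1 (Ordinal hN))//= -[leLHS]addr0 lerD//; last first.
  by apply: sumr_ge0 => i _; have /andP[] := bump_ext0_le1 p q (i%:R / N%:R).
have NR : 0 < N%:R :> R by rewrite ltr0n; lia.
apply: bump_floor_le.
rewrite ler_pdivlMr// ler_pdivrMr// ![2^-1 * _]mulrC ![3^-1 * _]mulrC.
by rewrite ler_pdivlMr// ler_pdivrMr// -!natrM !ler_nat; lia.
Qed.

Lemma weighted_averageE (u : nat -> R[i]) (N : nat) :
  ((weight_sum p q N)^-1)%:C *
    (\sum_(n < N) (weight p q (n%:R / N%:R))%:C * u n) =
  ((bump_sum N)^-1)%:C * (\sum_(n < N) (bump_ext p q 0 (n%:R / N%:R))%:C * u n).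
Proof.
have M0 := bump_mass_gt0.
have -> : weight_sum p q N = (bump_mass p q)^-1 * bump_sum N.
  by rewrite /bump_sum mulr_sumr; apply: eq_bigr => i _; rewrite weightE.
have -> : \sum_(n < N) (weight p q (n%:R / N%:R))%:C * u n = ((bump_mass p q)^-1)%:C *
    \sum_(n < N) (bump_ext p q 0 (n%:R / N%:R))%:C * u n.
  by rewrite mulr_sumr; apply: eq_bigr => i _; rewrite weightE rmorphM mulrA.
rewrite invfM invrK mulrA -rmorphM; congr (_%:C * _).
by rewrite mulrAC divff ?mul1r// gt_eqF.
Qed.

End weight_normalization.

(** * Integration on the torus *)

Section bounded_measurable.
Context {d : measure_display} {T : measurableType d} {R : realType}.
Implicit Types f g : T -> R.

(** Bounded measurable functions form an algebra and are integrable for every probability, so each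
    integrability condition reduces to closure under operations. *)
Definition bmeas f := measurable_fun setT f /\ exists M, forall x, `|f x| <= M.

Lemma bmeas_cst (c : R) : bmeas (fun=> c).
Proof. by split; [exact: measurable_cst | exists `|c|]. Qed.

Lemma bmeasD f g : bmeas f -> bmeas g -> bmeas (fun x => f x + g x).
Proof.
move=> [mf [M HM]] [mg [K HK]]; split; first exact: measurable_funD.
by exists (M + K) => x; rewrite (le_trans (ler_normD _ _))// lerD.
Qed.

Lemma bmeasM f g : bmeas f -> bmeas g -> bmeas (fun x => f x * g x).
Proof.
move=> [mf [M HM]] [mg [K HK]]; split; first exact: measurable_funM.
by exists (M * K) => x; rewrite normrM ler_pM.
Qed.

Lemma bmeasZ (c : R) f : bmeas f -> bmeas (fun x => c * f x).
Proof. by move=> mf; apply: bmeasM => //; exact: bmeas_cst. Qed.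

Lemma bmeasB f g : bmeas f -> bmeas g -> bmeas (fun x => f x - g x).
Proof.
move=> mf mg; have := bmeasD mf (bmeasZ (-1) mg).
by under eq_fun do rewrite mulN1r.
Qed.

Lemma bmeas_sum (I : Type) (s : seq I) (P : pred I) (F : I -> T -> R) :
  (forall i, bmeas (F i)) -> bmeas (fun x => \sum_(i <- s | P i) F i x).
Proof.
move=> mF; elim: s => [|i s IH].
  by under eq_fun do rewrite big_nil; exact: bmeas_cst.
under eq_fun do rewrite big_cons; case: (P i) => //.
exact: bmeasD.
Qed.

Variable mu : probability T R.

Lemma bmeas_integrable f : bmeas f -> mu.-integrable setT (EFin \o f).
Proof.
move=> [mf [M HM]]; apply: measurable_bounded_integrable => //.
  by apply: (le_lt_trans (y := 1%E)); [exact: probability_le1 | exact: ltry].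
exists M; split; first by rewrite num_real.
by move=> K MK x _; apply: le_trans (HM x) _; exact: ltW.
Qed.

Lemma Rint_cst (c : R) : \int[mu]_x c = c.
Proof.
have muT : mu setT = 1%E by exact: probability_setT.
by transitivity (c * fine (mu setT)); [exact: Rintegral_cst | rewrite muT mulr1].
Qed.

Lemma RintD f g : bmeas f -> bmeas g ->
  \int[mu]_x (f x + g x) = \int[mu]_x f x + \int[mu]_x g x.
Proof. by move=> mf mg; rewrite RintegralD//; exact: bmeas_integrable. Qed.

Lemma RintB f g : bmeas f -> bmeas g ->
  \int[mu]_x (f x - g x) = \int[mu]_x f x - \int[mu]_x g x.
Proof. by move=> mf mg; rewrite RintegralB//; exact: bmeas_integrable. Qed.

Lemma RintZ (c : R) f : bmeas f ->
  \int[mu]_x (c * f x) = c * \int[mu]_x f x.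
Proof. by move=> mf; rewrite RintegralZl//; exact: bmeas_integrable. Qed.

Lemma Rint_sum (I : Type) (s : seq I) (P : pred I) (F : I -> T -> R) :
  (forall i, bmeas (F i)) ->
  \int[mu]_x (\sum_(i <- s | P i) F i x) = \sum_(i <- s | P i) \int[mu]_x F i x.
Proof.
move=> mF; elim: s => [|i s IH].
  by under eq_Rintegral do rewrite big_nil; rewrite Rint_cst big_nil.
under eq_Rintegral do rewrite big_cons; rewrite big_cons.
case: (P i) => //; rewrite RintD// ?IH//.
exact: bmeas_sum.
Qed.

Lemma Rint_le f g : bmeas f -> bmeas g -> (forall x, f x <= g x) ->
  \int[mu]_x f x <= \int[mu]_x g x.
Proof. by move=> mf mg fg; rewrite le_Rintegral//; exact: bmeas_integrable. Qed.

Lemma Rint_normr f : bmeas f -> `|\int[mu]_x f x| <= \int[mu]_x `|f x|.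
Proof. by move=> mf; rewrite le_normr_Rintegral//; exact: bmeas_integrable. Qed.

End bounded_measurable.

Lemma bmeas_comp {d1 d2 : measure_display} {T1 : measurableType d1}
    {T2 : measurableType d2} {R : realType} (g : T2 -> R) (h : T1 -> T2) :
  measurable_fun setT h -> bmeas g -> bmeas (g \o h).
Proof.
move=> mh [mg [M HM]]; split; first exact: measurableT_comp.
by exists M => x; exact: HM.
Qed.

Lemma continuous_bmeas {R : realType} (g : R -> R) :
  continuous g -> (exists M, forall x, `|g x| <= M) ->
  bmeas (g : measurableTypeR R -> R).
Proof. by move=> cg Mg; split => //; exact: continuous_measurable_fun. Qed.

Lemma Rint_uniform_derive {R : realType} (F f : R -> R) :
  (forall x : R, is_derive x (1 : R) F (f x)) -> continuous f ->
  (forall x, `|f x| <= 1) ->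
  \int[uniform_prob (@ltr01 R)]_x f x = F 1 - F 0.
Proof.
move=> dF cf f1.
have mf : bmeas (f : measurableTypeR R -> R) by apply: continuous_bmeas => //; exists 1.
have mg : bmeas ((fun x => f x + 1) : measurableTypeR R -> R).
  by apply: bmeasD => //; exact: bmeas_cst.
(* The formula for integrals against the uniform law asks for a nonnegative integrand: 1 is added to
   f, and the primitive becomes F y + y. *)
apply: (@addIr _ (1 : R)); rewrite -[X in _ + X = _](Rint_cst (uniform_prob (@ltr01 R)) 1).
rewrite -RintD//; last exact: bmeas_cst.
rewrite /Rintegral integral_uniform//; last first.
- by move=> x; rewrite lee_fin; have := f1 x; rewrite ler_norml; lra.
- by apply/measurable_EFinP; case: mg.
rewrite subr0 invr1 mul1e.
have dG (x : R) : is_derive x (1 : R) (fun y => F y + y) (f x + 1).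
  have -> : (fun y : R => F y + y) = F + id by apply/funext.
  exact: is_deriveD.
have cG : continuous (fun y => F y + y).
  move=> x; apply: differentiable_continuous; apply/derivable1_diffP.
  exact: (@ex_derive _ _ _ _ _ _ _ (dG x)).
rewrite (@continuous_FTC2 _ _ (fun x => F x + x))//=.
- by rewrite addr0 addrAC.
- by apply: continuous_subspaceT => x; apply: cvgD; [exact: cf|exact: cvg_cst].
- split.
  + by move=> x _; exact: (@ex_derive _ _ _ _ _ _ _ (dG x)).
  + by apply: cvg_at_right_filter; exact: cG.
  + by apply: cvg_at_left_filter; exact: cG.
- by move=> x _; rewrite derive1E; exact: (@derive_val _ _ _ _ _ _ _ (dG x)).
Qed.

Section trigonometric_means.
Context {R : realType}.
Implicit Type l : int.

Let is_derive_scale (a x : R) : is_derive x (1 : R) (fun y => a * y) a.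
Proof.
have -> : (fun y : R => a * y) = a \*: (id : R -> R^o) by apply/funext.
by apply: is_derive_eq; rewrite [_ *: _]mulr1.
Qed.

Let freq_neq0 l : l != 0 -> 2 * pi * l%:~R != 0 :> R.
Proof. by move=> l0; rewrite !mulf_neq0// ?intr_eq0// gt_eqF// pi_gt0. Qed.

Lemma cos_sin_2pi_int l : cos (2 * pi * l%:~R) = 1 :> R /\ sin (2 * pi * l%:~R) = 0 :> R.
Proof.
have pos n : cos (2 * pi * n%:R) = 1 :> R /\ sin (2 * pi * n%:R) = 0 :> R.
  elim: n => [|n [IH1 IH2]]; first by rewrite mulr0 cos0 sin0.
  have -> : 2 * pi * n.+1%:R = 2 * pi * n%:R + pi *+ 2 :> R by rewrite -addn1 natrD; ring.
  by rewrite cosD2pi sinD2pi.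
case: l => n; first exact: pos.
by rewrite NegzE rmorphN /= mulrN cosN sinN !(pos _).1 !(pos _).2 oppr0.
Qed.

Lemma Rint_uniform_cos l : l != 0 ->
  \int[uniform_prob (@ltr01 R)]_x cos (2 * pi * (l%:~R * x)) = 0.
Proof.
move=> l0; set a : R := 2 * pi * l%:~R; have a0 : a != 0 by exact: freq_neq0.
under eq_Rintegral do rewrite mulrA -/a.
have dF (x : R) : is_derive x (1 : R) (fun y => a^-1 * sin (a * y)) (cos (a * x)).
  have ds : is_derive x (1 : R) (fun y => sin (a * y)) (cos (a * x) * a).
    exact: is_derive1_comp (is_derive_sin _) (is_derive_scale a x).
  have -> : (fun y => a^-1 * sin (a * y)) = a^-1 \*: ((fun y => sin (a * y)) : R -> R^o).
    by apply/funext.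
  by apply: is_derive_eq; rewrite [_ *: _]mulrC mulfK.
rewrite (Rint_uniform_derive dF).
- by rewrite mulr1 mulr0 sin0 /a (cos_sin_2pi_int l).2 subrr.
- by move=> x; apply: (@continuous_comp _ _ _ ( *%R a) (@cos R)); [exact: mulrl_continuous|exact: continuous_cos].
- by move=> x; exact: cos_max.
Qed.

Lemma Rint_uniform_sin l :
  \int[uniform_prob (@ltr01 R)]_x sin (2 * pi * (l%:~R * x)) = 0.
Proof.
have [->|l0] := eqVneq l 0.
  by under eq_Rintegral do rewrite mul0r mulr0 sin0; rewrite Rint_cst.
set a : R := 2 * pi * l%:~R; have a0 : a != 0 by exact: freq_neq0.
under eq_Rintegral do rewrite mulrA -/a.
have dF (x : R) : is_derive x (1 : R) (fun y => - a^-1 * cos (a * y)) (sin (a * x)).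
  have ds : is_derive x (1 : R) (fun y => cos (a * y)) (- sin (a * x) * a).
    exact: is_derive1_comp (is_derive_cos _) (is_derive_scale a x).
  have -> : (fun y => - a^-1 * cos (a * y)) = (- a^-1) \*: ((fun y => cos (a * y)) : R -> R^o).
    by apply/funext.
  by apply: is_derive_eq; rewrite [LHS](_ : _ = - a^-1 * (- sin (a * x) * a))//; field.
rewrite (Rint_uniform_derive dF).
- by rewrite mulr1 mulr0 cos0 /a (cos_sin_2pi_int l).1 subrr.
- by move=> x; apply: (@continuous_comp _ _ _ ( *%R a) (@sin R)); [exact: mulrl_continuous|exact: continuous_sin].
- by move=> x; exact: sin_max.
Qed.

End trigonometric_means.

Section complex_integral.
Context {d : measure_display} {T : measurableType d} {R : realType}.
Implicit Types f g : T -> R[i].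

Definition cbmeas f :=
  bmeas (fun x => complex.Re (f x)) /\ bmeas (fun x => complex.Im (f x)).

Lemma cbmeas_real (f : T -> R) : bmeas f -> cbmeas (fun x => (f x)%:C).
Proof. by move=> mf; split => //; exact: bmeas_cst. Qed.

Lemma cbmeas_cst (c : R[i]) : cbmeas (fun=> c).
Proof. by split; exact: bmeas_cst. Qed.

Lemma ReD (x y : R[i]) : complex.Re (x + y) = complex.Re x + complex.Re y.
Proof. by case: x; case: y. Qed.

Lemma ImD (x y : R[i]) : complex.Im (x + y) = complex.Im x + complex.Im y.
Proof. by case: x; case: y. Qed.

Lemma ReM (x y : R[i]) : complex.Re (x * y) =
  complex.Re x * complex.Re y - complex.Im x * complex.Im y.
Proof. by case: x; case: y. Qed.

Lemma ImM (x y : R[i]) : complex.Im (x * y) =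
  complex.Re x * complex.Im y + complex.Im x * complex.Re y.
Proof. by case: x => a b; case: y => u v /=; ring. Qed.

Lemma cbmeasD f g : cbmeas f -> cbmeas g -> cbmeas (fun x => f x + g x).
Proof.
move=> [f1 f2] [g1 g2]; split.
  by under eq_fun do rewrite ReD; exact: bmeasD.
by under eq_fun do rewrite ImD; exact: bmeasD.
Qed.

Lemma cbmeasM f g : cbmeas f -> cbmeas g -> cbmeas (fun x => f x * g x).
Proof.
move=> [f1 f2] [g1 g2]; split.
  by under eq_fun do rewrite ReM; apply: bmeasB; exact: bmeasM.
by under eq_fun do rewrite ImM; apply: bmeasD; exact: bmeasM.
Qed.

Lemma cbmeas_sum (I : Type) (s : seq I) (F : I -> T -> R[i]) :
  (forall i, cbmeas (F i)) -> cbmeas (fun x => \sum_(i <- s) F i x).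
Proof.
move=> mF; elim: s => [|i s IH].
  by under eq_fun do rewrite big_nil; exact: cbmeas_cst.
by under eq_fun do rewrite big_cons; exact: cbmeasD.
Qed.

Lemma cbmeas_prod (I : Type) (s : seq I) (F : I -> T -> R[i]) :
  (forall i, cbmeas (F i)) -> cbmeas (fun x => \prod_(i <- s) F i x).
Proof.
move=> mF; elim: s => [|i s IH].
  by under eq_fun do rewrite big_nil; exact: cbmeas_cst.
by under eq_fun do rewrite big_cons; exact: cbmeasM.
Qed.

Variable mu : probability T R.

Definition Cint f : R[i] :=
  (\int[mu]_x complex.Re (f x)) +i* (\int[mu]_x complex.Im (f x)).

Lemma Cint_real (f : T -> R) : Cint (fun x => (f x)%:C) = (\int[mu]_x f x)%:C.
Proof. by rewrite /Cint/= Rint_cst. Qed.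

Lemma Cint_cst (c : R[i]) : Cint (fun=> c) = c.
Proof. by rewrite /Cint !Rint_cst; case: c. Qed.

Lemma CintD f g : cbmeas f -> cbmeas g ->
  Cint (fun x => f x + g x) = Cint f + Cint g.
Proof.
move=> [f1 f2] [g1 g2]; rewrite /Cint.
under eq_Rintegral do rewrite ReD.
rewrite RintD//; under [X in _ +i* X]eq_Rintegral do rewrite ImD.
by rewrite RintD.
Qed.

Lemma CintZ (c : R[i]) f : cbmeas f -> Cint (fun x => c * f x) = c * Cint f.
Proof.
move=> [f1 f2]; rewrite /Cint.
under eq_Rintegral do rewrite ReM.
rewrite RintB; [|exact: bmeasZ..].
under [X in _ +i* X]eq_Rintegral do rewrite ImM.
rewrite RintD; [|exact: bmeasZ..].
rewrite !RintZ//; case: c => a b /=; apply/eqP; rewrite eq_complex /=.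
by apply/andP; split; apply/eqP; ring.
Qed.

Lemma Cint_sum (I : Type) (s : seq I) (F : I -> T -> R[i]) :
  (forall i, cbmeas (F i)) ->
  Cint (fun x => \sum_(i <- s) F i x) = \sum_(i <- s) Cint (F i).
Proof.
move=> mF; elim: s => [|i s IH].
  by under [X in Cint X]eq_fun do rewrite big_nil; rewrite Cint_cst big_nil.
under [X in Cint X]eq_fun do rewrite big_cons; rewrite big_cons.
by rewrite CintD// ?IH//; exact: cbmeas_sum.
Qed.

End complex_integral.

Section torus_product.
Context {R : realType}.
Local Notation U := (uniform_prob (@ltr01 R)).
Local Notation tm d := (torus_measure R d).

Lemma bmeas_tcons d (F : d.+1.-tuple (measurableTypeR R) -> R) :
  bmeas F -> bmeas (fun z => F (@tcons R d z)).
Proof. by move=> mF; apply: (bmeas_comp (@measurable_tcons R d)). Qed.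

Lemma bmeas_tnth d (g : measurableTypeR R -> R) (j : 'I_d) :
  bmeas g -> bmeas (fun x : d.-tuple (measurableTypeR R) => g (tnth x j)).
Proof.
move=> mg; apply: (@bmeas_comp _ _ _ _ _ g (fun x : d.-tuple (measurableTypeR R) => tnth x j)) => //.
exact: measurable_tnth.
Qed.

(** The torus measure is by construction the image under [tcons] of a product measure, so this is
    Fubini for separated variables. *)
Lemma Rint_torusS d (F : d.+1.-tuple (measurableTypeR R) -> R)
    (g : measurableTypeR R -> R) (h : d.-tuple (measurableTypeR R) -> R) :
  bmeas F -> bmeas g -> bmeas h ->
  (forall z, F (@tcons R d z) = g z.1 * h z.2) ->
  \int[tm d.+1]_x F x = \int[U]_x g x * \int[tm d]_x h x.
Proof.
move=> mF mg mh Fgh.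
have mFt := bmeas_tcons mF.
rewrite /Rintegral /=.
rewrite integral_distribution/=; last 2 first.
- by apply/measurable_EFinP; case: mF.
- exact: (bmeas_integrable _ mFt).
rewrite -integral12_prod_meas1/=; last exact: (bmeas_integrable _ mFt).
have H x : (\int[tm d]_y (F (tcons (x, y)))%:E = (g x * \int[tm d]_y h y)%:E)%E.
  rewrite -RintZ// /Rintegral fineK.
    by apply: eq_integral => y _; rewrite Fgh.
  by apply: integrable_fin_num => //; apply: (bmeas_integrable _ (bmeasZ _ mh)).
transitivity (\int[U]_x (g x * \int[tm d]_y h y)).
  by congr fine; apply: eq_integral => x _; exact: H.
under eq_Rintegral do rewrite mulrC.
by rewrite RintZ// mulrC.
Qed.

End torus_product.

(** * Characters of the torus and their orthogonality *)

Section characters.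
Context {R : realType}.
Implicit Types s t : R.

Lemma e2piD s t : e2pi (s + t) = e2pi s * e2pi t.
Proof.
by rewrite /e2pi mulrDr cosD sinD; apply/eqP; rewrite eq_complex /=;
  apply/andP; split; apply/eqP; ring.
Qed.

Lemma e2pi0 : e2pi 0 = 1 :> R[i].
Proof. by rewrite /e2pi mulr0 cos0 sin0. Qed.

Lemma e2pi_sum (I : Type) (r : seq I) (F : I -> R) :
  e2pi (\sum_(i <- r) F i) = \prod_(i <- r) e2pi (F i).
Proof.
elim: r => [|i r IH]; first by rewrite !big_nil e2pi0.
by rewrite !big_cons e2piD IH.
Qed.

Lemma e2pi_natmul t n : e2pi (n%:R * t) = e2pi t ^+ n.
Proof.
elim: n => [|n IH]; first by rewrite mul0r e2pi0.
by rewrite -natr1 mulrDl mul1r e2piD IH exprSr.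
Qed.

Lemma e2pi_int (l : int) : e2pi l%:~R = 1 :> R[i].
Proof. by rewrite /e2pi (cos_sin_2pi_int l).1 (cos_sin_2pi_int l).2. Qed.

Lemma normc_e2pi t : normc (e2pi t) = 1.
Proof. by rewrite /normc /e2pi cos2Dsin2 sqrtr1. Qed.

(** This links the small divisors, moduli of 1 - e^(2 i pi t), to the squared sines controlled by
    the kernel. *)
Lemma normc_1Be2pi t : normc (1 - e2pi t) ^+ 2 = 4 * sin (pi * t) ^+ 2.
Proof.
rewrite /normc /e2pi /= sqr_sqrtr ?addr_ge0 ?sqr_ge0//.
have -> : 2 * pi * t = (pi * t) *+ 2 by rewrite mulr2n; ring.
rewrite cos_mulr2n sin_mulr2n.
have := cos2sin2 (pi * t); set c := cos _; set s := sin _ => e.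
rewrite !mulr2n (_ : _ + _ = (2 - 2 * c ^+ 2) ^+ 2 + 4 * c ^+ 2 * s ^+ 2); last by ring.
by rewrite e; ring.
Qed.

Lemma continuous_e2pi_scale (a b : R) :
  continuous (fun t => complex.Re (e2pi (a * t + b))) /\
  continuous (fun t => complex.Im (e2pi (a * t + b))).
Proof.
have c x : {for x, continuous (fun t => 2 * pi * (a * t + b) : R)}.
  apply: cvgM; first exact: cvg_cst.
  apply: cvgD; last exact: cvg_cst.
  by apply: cvgM; [exact: cvg_cst | exact: cvg_id].
split => x /=.
  by apply: (@continuous_comp _ _ _ (fun t => 2 * pi * (a * t + b)) (@cos R)) => //; exact: continuous_cos.
by apply: (@continuous_comp _ _ _ (fun t => 2 * pi * (a * t + b)) (@sin R)) => //; exact: continuous_sin.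
Qed.

Lemma cbmeas_e2pi_scale (a b : R) :
  cbmeas ((fun t => e2pi (a * t + b)) : measurableTypeR R -> R[i]).
Proof.
have [c1 c2] := continuous_e2pi_scale a b; split; apply: continuous_bmeas => //.
  by exists 1 => x; exact: cos_max.
by exists 1 => x; exact: sin_max.
Qed.

Lemma cbmeas_e2pi_mul (a : R) :
  cbmeas ((fun t => e2pi (a * t)) : measurableTypeR R -> R[i]).
Proof.
by have := cbmeas_e2pi_scale a 0; congr cbmeas; apply/funext => t; rewrite addr0.
Qed.

Lemma cbmeas_tnth d (g : measurableTypeR R -> R[i]) (j : 'I_d) :
  cbmeas g -> cbmeas (fun x : d.-tuple (measurableTypeR R) => g (tnth x j)).
Proof.
by move=> [g1 g2]; split; [exact: (bmeas_tnth j g1) | exact: (bmeas_tnth j g2)].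
Qed.

(** The first coordinate is peeled off by induction on d. The real and imaginary parts of the
    product involve four real products, each separated by the real Fubini formula [E]. *)
Lemma Cint_torus_prod d (G : 'I_d -> measurableTypeR R -> R[i]) :
  (forall j, cbmeas (G j)) ->
  Cint (torus_measure R d) (fun x => \prod_(j < d) G j (tnth x j)) =
  \prod_(j < d) Cint (uniform_prob (@ltr01 R)) (G j).
Proof.
elim: d G => [|d IH] G mG.
  by under [X in Cint _ X]eq_fun do rewrite big_ord0; rewrite Cint_cst big_ord0.
rewrite [RHS]big_ord_recl -IH//.
pose P (x : d.-tuple (measurableTypeR R)) := \prod_(j < d) G (lift ord0 j) (tnth x j).
pose Q (x : d.+1.-tuple (measurableTypeR R)) := \prod_(j < d) G (lift ord0 j) (tnth x (lift ord0 j)).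
have mP : cbmeas P by apply: cbmeas_prod => j; exact: cbmeas_tnth.
have mQ : cbmeas Q by apply: cbmeas_prod => j; apply: (cbmeas_tnth (lift ord0 j)).
have m0 : cbmeas (fun x : d.+1.-tuple (measurableTypeR R) => G ord0 (tnth x ord0)).
  exact: cbmeas_tnth.
have QP z : Q (tcons z) = P z.2.
  by apply: eq_bigr => j _; rewrite tnthS.
under [X in Cint _ X]eq_fun do rewrite big_ord_recl -/(Q _).
rewrite /Cint.
have E (a : measurableTypeR R -> R) (b' : d.+1.-tuple (measurableTypeR R) -> R)
    (b : d.-tuple (measurableTypeR R) -> R) : bmeas a -> bmeas b' -> bmeas b ->
    (forall z, b' (tcons z) = b z.2) ->
    \int[torus_measure R d.+1]_x (a (tnth x ord0) * b' x) =
    \int[uniform_prob (@ltr01 R)]_x a x * \int[torus_measure R d]_x b x.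
  move=> ma mb' mb bb; apply: Rint_torusS => //.
    by apply: bmeasM => //; exact: bmeas_tnth.
  by move=> z; rewrite bb tnth0.
under eq_Rintegral do rewrite ReM.
under [X in _ +i* X]eq_Rintegral do rewrite ImM.
have [m01 m02] := m0; have [mP1 mP2] := mP; have [mQ1 mQ2] := mQ.
have [mG1 mG2] := mG ord0.
rewrite RintB; [|exact: bmeasM..].
rewrite RintD; [|exact: bmeasM..].
rewrite !(E (fun x => complex.Re (G ord0 x)) _ _ mG1 mQ1 mP1); last by move=> z; rewrite QP.
rewrite !(E (fun x => complex.Im (G ord0 x)) _ _ mG2 mQ2 mP2); last by move=> z; rewrite QP.
rewrite (E (fun x => complex.Re (G ord0 x)) _ _ mG1 mQ2 mP2); last by move=> z; rewrite QP.
rewrite (E (fun x => complex.Im (G ord0 x)) _ _ mG2 mQ1 mP1); last by move=> z; rewrite QP.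
by apply/eqP; rewrite eq_complex /=; apply/andP; split; apply/eqP; ring.
Qed.

Lemma Cint_uniform_e2pi (l : int) :
  Cint (uniform_prob (@ltr01 R)) (fun x => e2pi (l%:~R * x)) = (l == 0)%:R.
Proof.
have [->|l0] := eqVneq l 0.
  by under [X in Cint _ X]eq_fun do rewrite mul0r e2pi0; rewrite Cint_cst.
by rewrite /Cint /= Rint_uniform_cos// Rint_uniform_sin.
Qed.

Lemma Cint_torus_e2pi d (k : 'rV[int]_d) :
  Cint (torus_measure R d) (fun x => e2pi (\sum_(j < d) (k 0 j)%:~R * tnth x j)) =
  (k == 0)%:R.
Proof.
under [X in Cint _ X]eq_fun do rewrite e2pi_sum.
rewrite (Cint_torus_prod (G := fun j t => e2pi ((k 0 j)%:~R * t))); last first.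
  by move=> j; exact: cbmeas_e2pi_mul.
under eq_bigr do rewrite Cint_uniform_e2pi.
have [->|/eqP k0] := eqVneq k 0.
  by rewrite big1// => j _; rewrite mxE eqxx.
have [j kj|H] := pickP (fun j => k 0 j != 0); first by rewrite (bigD1 j)//= (negbTE kj) mul0r.
exfalso; apply: k0; apply/rowP => j; rewrite mxE.
by have := H j; move/negbFE/eqP.
Qed.

End characters.

(** * Fourier approximation of continuous periodic functions *)

Section kernel.
Context {R : realType}.
Implicit Type t : R.

(** The coefficient at frequency l - K of the de la Vallee Poussin kernel, a power of the cosine
    expanded by the binomial theorem. Dividing by the central coefficient, the largest one, makes
    the mean equal to 1 and places all coefficients in [0, 1]. *)
Definition kernel_coef (K l : nat) : R := 'C(K.*2, l)%:R / 'C(K.*2, K)%:R.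

Definition kernel (K : nat) t : R := 4 ^+ K / 'C(K.*2, K)%:R * cos (pi * t) ^+ K.*2.

Lemma central_bin_gt0 K : 0 < 'C(K.*2, K)%:R :> R.
Proof. by rewrite ltr0n bin_gt0 -addnn leq_addr. Qed.

Lemma kernelE K t : (kernel K t)%:C =
  \sum_(l < K.*2.+1) (kernel_coef K l)%:C * e2pi ((l%:Z - K%:Z)%:~R * t).
Proof.
have Ee : (2 * cos (pi * t))%:C = e2pi (- t / 2) + e2pi (t / 2).
  rewrite /e2pi (_ : 2 * pi * (- t / 2) = - (pi * t)); last by field.
  rewrite (_ : 2 * pi * (t / 2) = (pi * t)); last by field.
  by rewrite cosN sinN; apply/eqP; rewrite eq_complex /=; apply/andP; split; apply/eqP; ring.
have -> : (kernel K t)%:C = (('C(K.*2, K)%:R)^-1)%:C * (2 * cos (pi * t))%:C ^+ K.*2.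
  rewrite -rmorphXn -rmorphM; congr (_%:C).
  have e4 : 2 ^+ K.*2 = 4 ^+ K :> R by rewrite -muln2 mulnC exprM; congr (_ ^+ _); ring.
  by rewrite /kernel exprMn e4; ring.
rewrite Ee exprDn mulr_sumr; apply: eq_bigr => -[l lK] _ /=.
rewrite /kernel_coef mulrC.
have -> : e2pi (- t / 2) ^+ (K.*2 - l) * e2pi (t / 2) ^+ l = e2pi ((l%:Z - K%:Z)%:~R * t).
  rewrite -!e2pi_natmul -e2piD; congr e2pi.
  by rewrite natrB -?muln2 ?natrM//= ?rmorphB /=; [field|lia].
rewrite -mulr_natl rmorphM rmorph_nat; ring.
Qed.

Lemma kernel_ge0 K t : 0 <= kernel K t.
Proof.
rewrite /kernel mulr_ge0//.
by rewrite -muln2 mulnC exprM exprn_ge0 ?sqr_ge0.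
Qed.

Lemma kernel_coef_ge0 K l : 0 <= kernel_coef K l.
Proof. by rewrite divr_ge0. Qed.

Lemma kernel_coefK K : kernel_coef K K = 1.
Proof. by rewrite /kernel_coef divff// gt_eqF ?central_bin_gt0. Qed.

End kernel.

Section kernel_means.
Context {R : realType}.
Local Notation U := (uniform_prob (@ltr01 R)).
Implicit Types t x : R.

Lemma bmeas_kernel K (t : R) :
  bmeas ((fun y => kernel K (t - y)) : measurableTypeR R -> R).
Proof.
apply: continuous_bmeas.
  move=> x; apply: cvgM; first exact: cvg_cst.
  apply: (@continuous_comp _ _ _ (fun y : R => cos (pi * (t - y))) (fun z : R => z ^+ K.*2)).
    apply: (@continuous_comp _ _ _ (fun y : R => pi * (t - y)) (@cos R)); last exact: continuous_cos.
    apply: cvgM; first exact: cvg_cst.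
    by apply: cvgB; [exact: cvg_cst|exact: cvg_id].
  exact: exprn_continuous.
exists (4 ^+ K / 'C(K.*2, K)%:R) => y.
by rewrite ger0_norm ?kernel_ge0// /kernel ler_piMr.
Qed.

Lemma Rint_kernel K t : \int[U]_y kernel K (t - y) = 1.
Proof.
suff : (\int[U]_y kernel K (t - y))%:C = 1 :> R[i] by case.
rewrite -Cint_real.
have -> : (fun y => (kernel K (t - y))%:C) = (fun y => \sum_(l < K.*2.+1)
    (kernel_coef K l)%:C * e2pi ((l%:Z - K%:Z)%:~R * t) * e2pi ((K%:Z - l%:Z)%:~R * y)).
  apply/funext => y; rewrite kernelE; apply: eq_bigr => l _.
  by rewrite -mulrA -e2piD; congr (_ * e2pi _); rewrite !rmorphB /=; ring.
have mE (l : nat) : cbmeas ((fun y => e2pi ((K%:Z - l%:Z)%:~R * y)) : measurableTypeR R -> R[i]).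
  exact: cbmeas_e2pi_mul.
rewrite Cint_sum; last by move=> l; apply: cbmeasM => //; exact: cbmeas_cst.
have hK : (K < K.*2.+1)%N by lia.
rewrite (bigD1 (Ordinal hK))//= big1 ?addr0 => [|l lK].
  rewrite CintZ// Cint_uniform_e2pi subrr eqxx mulr1 mul0r e2pi0 mulr1.
  by rewrite kernel_coefK.
rewrite CintZ// Cint_uniform_e2pi subr_eq0 eqz_nat.
rewrite (_ : K == l = false) ?mulr0//; apply/negbTE; rewrite eq_sym.
by apply: contra lK => /eqP lK; apply/eqP/val_inj.
Qed.

Lemma central_binS K :
  (K.+1 * 'C(K.+1.*2, K.+1) = 2 * (K.*2.+1 * 'C(K.*2, K)))%N.
Proof.
rewrite doubleS -(mul_bin_diag K.*2.+2 K) /= (mul_bin_down K.*2.+1 K).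
have -> : (K.*2.+1 - K = K.+1)%N by lia.
by rewrite mulnA mul2n doubleS.
Qed.

(** Multiplication by cos^2 raises K by one, up to the ratio of the normalizations. Hence the sin^2
    moment of the kernel is 1 - (2 K + 1) / (2 K + 2) = 1 / (2 K + 2), which tends to 0. *)
Lemma kernelS K t : cos (pi * t) ^+ 2 * kernel K t =
  (K.*2.+1)%:R / (K.*2.+2)%:R * kernel K.+1 t.
Proof.
rewrite /kernel doubleS !exprS.
have c0 := gt_eqF (central_bin_gt0 (R := R) K).
have c1 := gt_eqF (central_bin_gt0 (R := R) K.+1).
have := congr1 (fun n => n%:R : R) (central_binS K).
rewrite /= !natrM doubleS => e.
have -> : (K.*2.+2)%:R = 2 * K.+1%:R :> R by rewrite -natrM mul2n doubleS.
have k1 : K.+1%:R != 0 :> R by rewrite pnatr_eq0.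
rewrite doubleS in c1.
have -> : (K.*2.+1)%:R = K.+1%:R * 'C(K.*2.+2, K.+1)%:R / (2 * 'C(K.*2, K)%:R) :> R.
  by rewrite e; field; rewrite c0.
by field; rewrite c0 c1 nat1r pnatr_eq0.
Qed.

Lemma Rint_sin2_kernel K t :
  \int[U]_y (sin (pi * (t - y)) ^+ 2 * kernel K (t - y)) = (K.*2.+2)%:R^-1.
Proof.
under eq_Rintegral do rewrite sin2cos2 mulrBl mul1r kernelS.
rewrite RintB; [|exact: bmeas_kernel|by apply: bmeasZ; exact: bmeas_kernel].
rewrite (RintZ _ _ (bmeas_kernel K.+1 t)).
have n0 : (K.*2.+2)%:R != 0 :> R by rewrite pnatr_eq0.
move: n0; rewrite !Rint_kernel mulr1 -(natr1 K.*2.+1).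
by move: (K.*2.+1)%:R => u u1; field.
Qed.

Lemma bmeas_sin2_kernel K t :
  bmeas ((fun y => sin (pi * (t - y)) ^+ 2 * kernel K (t - y)) : measurableTypeR R -> R).
Proof.
have -> : (fun y => sin (pi * (t - y)) ^+ 2 * kernel K (t - y)) =
    (fun y => kernel K (t - y) - (K.*2.+1)%:R / (K.*2.+2)%:R * kernel K.+1 (t - y)).
  by apply/funext => y; rewrite sin2cos2 mulrBl mul1r kernelS.
by apply: bmeasB; [|apply: bmeasZ]; exact: bmeas_kernel.
Qed.

Lemma Rint_torus_prod d (G : 'I_d -> measurableTypeR R -> R) :
  (forall j, bmeas (G j)) ->
  \int[torus_measure R d]_x \prod_(j < d) G j (tnth x j) =
  \prod_(j < d) \int[U]_t G j t.
Proof.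
move=> mG; suff : (\int[torus_measure R d]_x \prod_(j < d) G j (tnth x j))%:C =
  (\prod_(j < d) \int[U]_t G j t)%:C :> R[i] by case.
rewrite -Cint_real rmorph_prod.
under [X in Cint _ X]eq_fun do rewrite rmorph_prod.
rewrite (Cint_torus_prod (G := fun j t => (G j t)%:C)).
  by apply: eq_bigr => j _; rewrite Cint_real.
by move=> j; exact: cbmeas_real.
Qed.

Lemma bmeas_torus_prod d (G : 'I_d -> measurableTypeR R -> R) :
  (forall j, bmeas (G j)) ->
  bmeas (fun x : d.-tuple (measurableTypeR R) => \prod_(j < d) G j (tnth x j)).
Proof.
move=> mG.
have [] : cbmeas (fun x : d.-tuple (measurableTypeR R) => \prod_(j < d) (G j (tnth x j))%:C).
  by apply: cbmeas_prod => j; apply: cbmeas_real; exact: bmeas_tnth.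
by under eq_fun do rewrite -rmorph_prod.
Qed.

End kernel_means.

(** * Korovkin approximation *)

Section korovkin.
Context {R : realType} {d : nat}.
Local Notation tm := (torus_measure R d).
Implicit Types x y : 'rV[R]_d.

Lemma sin2_pi_int (t : R) (n : int) : sin (pi * (t + n%:~R)) ^+ 2 = sin (pi * t) ^+ 2.
Proof.
have h : 4 * sin (pi * (t + n%:~R)) ^+ 2 = 4 * sin (pi * t) ^+ 2.
  by rewrite -!normc_1Be2pi e2piD e2pi_int mulr1.
lra.
Qed.

Lemma sin2_pi_ge (t delta : R) : 0 < delta -> delta <= `|t| -> `|t| <= 2^-1 ->
  sin (pi * delta) ^+ 2 <= sin (pi * t) ^+ 2.
Proof.
move=> d0 dt t2.
have p0 : 0 < pi :> R by exact: pi_gt0.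
have -> : sin (pi * t) ^+ 2 = sin (pi * `|t|) ^+ 2.
  by case: (ger0P t) => // _; rewrite mulrN sinN sqrrN.
have s0 (u : R) : 0 <= u <= 2^-1 -> 0 <= sin (pi * u).
  move=> /andP[u0 u2]; apply: sin_ge0_pi; apply/andP; split.
    by rewrite mulr_ge0// ltW.
  by rewrite ler_piMr ?(ltW p0)//; lra.
rewrite lerXn2r ?nnegrE ?s0 ?normr_ge0 ?(ltW d0) ?(le_trans dt)//.
move: dt; rewrite le_eqVlt => /predU1P[->//|dt].
have itv (u : R) : 0 <= u <= 2^-1 -> pi * u \in `[(- (pi / 2)), pi / 2].
  move=> /andP[u0 u2]; rewrite in_itv/= ler_pM2l// u2 andbT.
  by apply: (@le_trans _ _ 0); rewrite ?oppr_le0 ?mulr_ge0 ?invr_ge0// ltW.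
by apply: ltW; rewrite ltr_sin ?ltr_pM2l// itv// ?normr_ge0 ?(ltW d0)// (ltW (lt_le_trans dt t2)).
Qed.

(** Near x modulo periods, continuity gives e. Elsewhere some coordinate of y is at distance at
    least delta from x_j + Z, so the sum of squared sines is at least s = sin^2 (pi delta), and 2 M
    / s times it exceeds the trivial bound 2 M. *)
Lemma korovkin_bound (g : 'rV[R]_d -> R) x (M e : R) :
  (forall y (k : 'rV[int]_d), g (y + rv_of_int R k) = g y) ->
  {for x, continuous g} -> (forall y, `|g y| <= M) -> 0 < e ->
  exists2 C, 0 <= C & forall y,
    `|g y - g x| <= e + C * \sum_(j < d) sin (pi * (x 0 j - y 0 j)) ^+ 2.
Proof.
move=> gper cg gM e0.
have M0 : 0 <= M := le_trans (normr_ge0 _) (gM 0).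
have [delta' delta'0 Hd] : exists2 dl : R, 0 < dl & forall y,
    (forall j, `|y 0 j - x 0 j| < dl) -> `|g y - g x| <= e.
  have /cvgrPdist_le/(_ e e0)/nbhs_ballP[dl /= dl0 H] := cg.
  exists dl => // y yx; rewrite distrC; apply: H; split => // i j.
  by rewrite ord1 /ball /= distrC; exact: yx.
pose delta := Num.min delta' 2^-1.
have delta0 : 0 < delta by rewrite lt_min delta'0 invr_gt0/=.
have deltad' : delta <= delta' by rewrite ge_min lexx.
have delta2 : delta <= 2^-1 by rewrite ge_min lexx orbT.
have p0 : 0 < pi :> R by exact: pi_gt0.
pose s := sin (pi * delta) ^+ 2.
have s0 : 0 < s.
  rewrite exprn_gt0// sin_gt0_pi//; apply/andP; split; first by rewrite mulr_gt0.
  by rewrite gtr_pMr//; lra.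
have C0 : 0 <= 2 * M / s by apply: divr_ge0 (ltW s0); exact: mulr_ge0.
exists (2 * M / s) => // y.
(* [y'] is the integer translate of y whose coordinates lie within 1/2 of those of x, a range where
   sin^2 increases with the distance. *)
pose n : 'rV[int]_d := \row_j - Num.floor (y 0 j - x 0 j + 2^-1).
pose y' := y + rv_of_int R n.
have y'E j : y' 0 j = y 0 j + (n 0 j)%:~R by rewrite !mxE.
have y'2 j : `|y' 0 j - x 0 j| <= 2^-1.
  rewrite y'E mxE rmorphN /=.
  have := ge_floor (y 0 j - x 0 j + 2^-1); have := floorD1_gt (y 0 j - x 0 j + 2^-1).
  by rewrite rmorphD /= ler_norml => ? ?; lra.
have sE j : sin (pi * (x 0 j - y 0 j)) ^+ 2 = sin (pi * (y' 0 j - x 0 j)) ^+ 2.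
  rewrite -[RHS]sqrrN -sinN -mulrN opprB y'E.
  by rewrite -(sin2_pi_int _ (- n 0 j)) rmorphN /=; congr (sin (pi * _) ^+ 2); ring.
have sum0 : 0 <= \sum_(j < d) sin (pi * (x 0 j - y 0 j)) ^+ 2.
  by apply: sumr_ge0 => j _; exact: sqr_ge0.
rewrite -(gper y n) -/y'.
have [/forallP H|] := boolP [forall j, `|y' 0 j - x 0 j| < delta].
  apply: le_trans (Hd y' _) _; first by move=> j; rewrite (lt_le_trans (H j)).
  by rewrite lerDl mulr_ge0.
rewrite negb_forall => /existsP[j]; rewrite -leNgt => dj.
apply: (@le_trans _ _ (2 * M)).
  by rewrite (le_trans (ler_normB _ _))// mulr2n mulrDl mul1r lerD.
have : s <= \sum_(j < d) sin (pi * (x 0 j - y 0 j)) ^+ 2.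
  rewrite (bigD1 j)//= -[s]addr0 lerD//.
    by rewrite sE sin2_pi_ge.
  by apply: sumr_ge0 => i _; exact: sqr_ge0.
move: sum0; set S := (\sum_(j < d) _) => sum0 sS.
rewrite -[leLHS]add0r lerD//; first exact: ltW.
by rewrite mulrAC ler_pdivlMr// ler_wpM2l// mulr_ge0.
Qed.

Definition kernel_prod K x (y : d.-tuple (measurableTypeR R)) : R :=
  \prod_(j < d) kernel K (x 0 j - tnth y j).

Lemma bmeas_kernel_prod K x : bmeas (kernel_prod K x).
Proof.
apply: (bmeas_torus_prod (G := fun j t => kernel K (x 0 j - t))) => j.
exact: bmeas_kernel.
Qed.

Lemma Rint_kernel_prod K x : \int[tm]_y kernel_prod K x y = 1.
Proof.
rewrite (Rint_torus_prod (G := fun j t => kernel K (x 0 j - t))).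
  by apply: big1 => j _; rewrite Rint_kernel.
by move=> j; exact: bmeas_kernel.
Qed.

Let sin2G K x i j t : R :=
  (if j == i then sin (pi * (x 0 j - t)) ^+ 2 else 1) * kernel K (x 0 j - t).

Let sin2GE (K : nat) x (i : 'I_d) (z : d.-tuple (measurableTypeR R)) :
  sin (pi * (x 0 i - tnth z i)) ^+ 2 * kernel_prod K x z =
  \prod_(j < d) sin2G K x i j (tnth z j).
Proof.
rewrite big_split /= -/(kernel_prod K x z); congr (_ * _).
by rewrite (bigD1 i)//= eqxx big1 ?mulr1// => j /negbTE ->.
Qed.

Let bmeas_sin2G K x i j : bmeas (sin2G K x i j : measurableTypeR R -> R).
Proof.
rewrite /sin2G; case: eqP => _; first exact: bmeas_sin2_kernel.
by under eq_fun do rewrite mul1r; exact: bmeas_kernel.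
Qed.

Lemma bmeas_sin2_kernel_prod K x (i : 'I_d) :
  bmeas (fun z : d.-tuple (measurableTypeR R) =>
    sin (pi * (x 0 i - tnth z i)) ^+ 2 * kernel_prod K x z).
Proof.
under eq_fun do rewrite sin2GE.
by apply: (bmeas_torus_prod (G := sin2G K x i)) => j; exact: bmeas_sin2G.
Qed.

Lemma Rint_sin2_kernel_prod K x (i : 'I_d) :
  \int[tm]_y (sin (pi * (x 0 i - tnth y i)) ^+ 2 * kernel_prod K x y) = (K.*2.+2)%:R^-1.
Proof.
under eq_Rintegral do rewrite sin2GE.
rewrite (Rint_torus_prod (G := sin2G K x i)); last by move=> j; exact: bmeas_sin2G.
rewrite (bigD1 i)//= big1 => [|j /negbTE ji].
  by rewrite mulr1 /sin2G eqxx Rint_sin2_kernel.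
rewrite /sin2G ji; under eq_Rintegral do rewrite mul1r.
exact: Rint_kernel.
Qed.

(* The kernel integrates the majorant [e + C * sum_j sin^2 (pi (x_j - y_j))]
   exactly, which gives convergence without splitting the integral. *)
Lemma kernel_prod_approx (g : 'rV[R]_d -> R) x (M e : R) :
  (forall y (k : 'rV[int]_d), g (y + rv_of_int R k) = g y) ->
  {for x, continuous g} -> (forall y, `|g y| <= M) ->
  bmeas (fun y : d.-tuple (measurableTypeR R) => g (rv_of_tuple y)) -> 0 < e ->
  exists K0, forall K, (K0 <= K)%N ->
    `|\int[tm]_y (g (rv_of_tuple y) * kernel_prod K x y) - g x| <= e.
Proof.
move=> gper cg gM mg e0.
have e2 : 0 < e / 2 by rewrite divr_gt0.
have [C C0 HC] := korovkin_bound gper cg gM e2.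
(* For K above C d / e, the squared sines contribute C d / (2 K + 2) <= e / 2. *)
exists (Num.bound (C * d%:R / e)) => K K0.
have mk := bmeas_kernel_prod K x.
have -> : \int[tm]_y (g (rv_of_tuple y) * kernel_prod K x y) - g x =
    \int[tm]_y ((g (rv_of_tuple y) - g x) * kernel_prod K x y).
  under [RHS]eq_Rintegral do rewrite mulrBl.
  rewrite RintB; [|exact: bmeasM|exact: bmeasZ].
  by rewrite RintZ// Rint_kernel_prod mulr1.
have mgx : bmeas (fun y : d.-tuple (measurableTypeR R) => g (rv_of_tuple y) - g x).
  by apply: bmeasB => //; exact: bmeas_cst.
have ms := fun i => bmeas_sin2_kernel_prod K x i.
have mS : bmeas (fun y : d.-tuple (measurableTypeR R) =>
    \sum_(i < d) (sin (pi * (x 0 i - tnth y i)) ^+ 2 * kernel_prod K x y)).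
  exact: bmeas_sum.
have mabs : bmeas (fun y : d.-tuple (measurableTypeR R) =>
    `|(g (rv_of_tuple y) - g x) * kernel_prod K x y|).
  have [m1 [M1 H1]] := bmeasM mgx mk; split; first exact: measurableT_comp.
  by exists M1 => y; rewrite normr_id; exact: H1.
apply: le_trans (Rint_normr _ (bmeasM mgx mk)) _.
apply: (@le_trans _ _ (\int[tm]_y (e / 2 * kernel_prod K x y +
    C * \sum_(i < d) (sin (pi * (x 0 i - tnth y i)) ^+ 2 * kernel_prod K x y)))).
  apply: Rint_le => //.
    by apply: bmeasD; exact: bmeasZ.
  move=> y.
  have k0 : 0 <= kernel_prod K x y by apply: prodr_ge0 => j _; exact: kernel_ge0.
  rewrite normrM (ger0_norm k0) -mulr_suml mulrA -mulrDl ler_wpM2r//.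
  have := HC (rv_of_tuple y).
  by under eq_bigr do rewrite mxE.
rewrite RintD; [|exact: bmeasZ..].
rewrite !RintZ// Rint_kernel_prod Rint_sum//.
under eq_bigr do rewrite Rint_sin2_kernel_prod.
rewrite sumr_const card_ord mulr1 -[_^-1 *+ d]mulr_natr.
have K1 : C * d%:R / e < K%:R.
  apply: lt_le_trans (_ : (Num.bound (C * d%:R / e))%:R <= _); last by rewrite ler_nat.
  by apply: archi_boundP; rewrite divr_ge0 ?(ltW e0)// mulr_ge0.
have -> : (K.*2.+2)%:R = 2 * (K%:R + 1) :> R by rewrite natr1 -natrM mul2n doubleS.
have kp : 0 < K%:R + 1 :> R by rewrite ltr_wpDl.
move: K1; rewrite ltr_pdivrMr// => K1.
have : C * (d%:R / (2 * (K%:R + 1))) <= e / 2.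
  rewrite mulrA ler_pdivrMr ?mulr_gt0//; nra.
by rewrite [d%:R / _]mulrC; lra.
Qed.

End korovkin.

Section torus_functions.
Context {R : realType} {d : nat}.

Lemma coord_le_norm (x : 'rV[R]_d) (j : 'I_d) : `|x 0 j| <= `|x|.
Proof.
have /mapP[i Hi ->] : `|x 0 j| \in [seq `|x i.1 i.2| | i : 'I_1 * 'I_d].
  by apply/mapP; exists (0, j) => //=; rewrite mem_enum.
by rewrite [leRHS]/Num.Def.normr/= mx_normrE; apply/bigmax_geP; right => /=; exists i.
Qed.

Lemma norm_le_coord (x : 'rV[R]_d) (e : R) : 0 <= e -> (forall j, `|x 0 j| <= e) -> `|x| <= e.
Proof.
move=> e0 H; rewrite [leLHS]/Num.Def.normr/= mx_normrE; apply: bigmax_le => // -[i j] _ /=.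
by rewrite ord1.
Qed.

(** The topology lives on row vectors and the sigma-algebra on tuples. The bridge is a grid of mesh
    1 / (n + 1): a continuous function is the pointwise limit of its values at the corners of the
    cells, which are step functions on countably many boxes. *)
Definition grid_point (n : nat) (k : 'rV[int]_d) : 'rV[R]_d :=
  \row_j ((k 0 j)%:~R / n.+1%:R).

Definition grid_index (n : nat) (x : d.-tuple (measurableTypeR R)) : 'rV[int]_d :=
  \row_j Num.floor (n.+1%:R * (tnth x j : R)).

Lemma measurable_grid (n : nat) (F : 'rV[int]_d -> R) :
  measurable_fun setT (fun x => F (grid_index n x)).
Proof.
move=> _ Y mY; rewrite setTI.
have -> : (fun x => F (grid_index n x)) @^-1` Y =
    \bigcup_k (if `[< Y (F k) >] then grid_index n @^-1` [set k] else set0).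
  apply/seteqP; split => x /=.
    by move=> Yx; exists (grid_index n x) => //; rewrite asboolT.
  by move=> [k _]; case: asboolP => //= Yk ->.
apply: countable_bigcupT_measurable => // k.
case: asboolP => // _.
have -> : grid_index n @^-1` [set k] =
    \bigcap_(j : 'I_d) ((fun x : d.-tuple (measurableTypeR R) => tnth x j) @^-1`
      `[(k 0 j)%:~R / n.+1%:R, (k 0 j + 1)%:~R / n.+1%:R[).
  have n0 : 0 < n.+1%:R :> R by [].
  have E (t : R) (z : int) : (Num.floor (n.+1%:R * t) == z) =
      (t \in `[z%:~R / n.+1%:R, (z + 1)%:~R / n.+1%:R[).
    by rewrite floor_eq in_itv/= ler_pdivrMr// ltr_pdivlMr// mulrC.
  apply/seteqP; split => x /=.
    by move=> <- j _ /=; rewrite -E mxE.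
  move=> H; apply/rowP => j; rewrite mxE; apply/eqP; rewrite E.
  exact: H.
apply: fin_bigcap_measurable => // j _.
rewrite -[X in measurable X]setTI; apply: measurable_tnth => //.
Qed.

Lemma measurable_continuous_torus (g : 'rV[R]_d -> R) : continuous g ->
  measurable_fun setT (fun x : d.-tuple (measurableTypeR R) => g (rv_of_tuple x)).
Proof.
move=> cg.
apply: (@measurable_fun_cvg _ _ _ _ (fun n x => g (grid_point n (grid_index n x)))).
  by move=> n; exact: (measurable_grid n (fun k => g (grid_point n k))).
move=> x _.
apply: (@cvg_comp _ _ _ (fun n => grid_point n (grid_index n x)) g _ (nbhs (rv_of_tuple x))); last exact: cg.
apply/cvgrPdist_le => e e0; near=> n.
apply: norm_le_coord => [|j]; first exact: ltW.
rewrite !mxE; set t := tnth x j : R.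
have n0 : 0 < n.+1%:R :> R by [].
have h1 := ge_floor (n.+1%:R * t); have h2 := floorD1_gt (n.+1%:R * t).
have -> : t - (Num.floor (n.+1%:R * t))%:~R / n.+1%:R =
    (n.+1%:R * t - (Num.floor (n.+1%:R * t))%:~R) / n.+1%:R.
  by rewrite mulrBl mulrAC divff ?mul1r// gt_eqF.
rewrite ger0_norm; last by rewrite divr_ge0// subr_ge0.
apply: (@le_trans _ _ n.+1%:R^-1).
  rewrite ler_piMl ?invr_ge0//; move: h2; rewrite rmorphD /=; lra.
apply: ltW; near: n; exact: near_infty_natSinv_lt (PosNum e0).
Unshelve. all: by end_near.
Qed.

Lemma periodic_bounded (g : 'rV[R]_d -> R) : continuous g ->
  (forall y (k : 'rV[int]_d), g (y + rv_of_int R k) = g y) ->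
  exists M, forall y, `|g y| <= M.
Proof.
move=> cg gper.
have cA := @rV_compact R d (fun=> `[0, 1]%classic) (fun=> @segment_compact R 0 1).
have cgA := continuous_compact (continuous_subspaceT cg) cA.
have [M [Mr HM]] := compact_bounded cgA.
exists (M + 1) => y.
pose k : 'rV[int]_d := \row_j - Num.floor (y 0 j).
rewrite -(gper y k); apply: (HM (M + 1)); first by rewrite ltrDl.
exists (y + rv_of_int R k) => // j; rewrite /= !mxE in_itv/= rmorphN /=.
have h1 := ge_floor (y 0 j); have h2 := floorD1_gt (y 0 j).
by move: h2; rewrite rmorphD /= => h2; apply/andP; split; lra.
Qed.

(** This is the equivalence of norms: [nrm] is Lipschitz for the sup norm, hence attains a minimum
    on the compact unit sphere, and this minimum is positive. *)
Lemma is_norm_lower_bound (nrm : 'rV[R]_d -> R) : is_norm nrm ->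
  exists2 c, 0 < c & forall (x : 'rV[R]_d) j, c * `|x 0 j| <= nrm x.
Proof.
move=> [n0 neq0 nZ nD].
have nN (x : 'rV[R]_d) : nrm (- x) = nrm x by rewrite -scaleN1r nZ normrN1 mul1r.
pose B := \sum_(j < d) nrm (delta_mx 0 j).
have nB (x : 'rV[R]_d) : nrm x <= B * `|x|.
  rewrite [in leLHS](row_sum_delta x).
  rewrite /B mulr_suml.
  have n00 : nrm 0 = 0 by rewrite -(scale0r (0 : 'rV[R]_d)) nZ normr0 mul0r.
  elim/big_ind2 : _ => [|u a v b ua vb|j _]; first by rewrite n00.
    by apply: le_trans (nD _ _) _; exact: lerD.
  by rewrite nZ mulrC ler_wpM2l// coord_le_norm.
have ndist (x y : 'rV[R]_d) : `|nrm x - nrm y| <= B * `|x - y|.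
  apply: le_trans (nB _); rewrite ler_norml; apply/andP; split.
    rewrite lerNl opprB lerBlDr -[nrm (x - y)]nN opprB.
    by apply: le_trans (nD _ _); rewrite subrK.
  by rewrite lerBlDr; apply: le_trans (nD _ _); rewrite subrK.
have B0 : 0 <= B by apply: sumr_ge0.
have cn : continuous nrm.
  move=> x; have FF : Filter (nbhs x) := @nbhs_filter _ x.
  apply/cvgrPdist_le => e e0; apply/(@nbhs_ballP R 'rV[R]_d).
  have eB : 0 < e / (B + 1) by rewrite divr_gt0// ltr_wpDl.
  exists (e / (B + 1)) => // y [_ xy]; apply: le_trans (ndist _ _) _.
  have : `|x - y| <= e / (B + 1).
    apply: norm_le_coord => [|j]; first exact: ltW.
    by rewrite !mxE; exact: ltW (xy 0 j).
  rewrite ler_pdivlMr ?ltr_wpDl//; have := normr_ge0 (x - y); nra.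
pose S : set 'rV[R]_d := [set x | `|x| = 1].
have cS : compact S.
  apply: bounded_closed_compact.
    by exists 1; split => // M M1 x /= ->; exact: ltW.
  rewrite (_ : S = Num.norm @^-1` [set 1]) //.
  by apply: closed_comp => [x _|]; [exact: norm_continuous|exact: closed_eq].
(* The sphere is empty only in dimension 0, where every vector is zero. *)
have [[x0 Sx0]|S0] := pselect (S !=set0); last first.
  exists 1 => // x j; have [->|x0] := eqVneq x 0; first by rewrite mxE normr0 mulr0 n0.
  exfalso; apply: S0; exists (`|x|^-1 *: x); rewrite /S /= normrZ normfV normr_id mulVf//.
  by rewrite normr_eq0.
have [m Sm Hm] := EVT_min_rV (ex_intro _ x0 Sx0) cS (continuous_subspaceT cn).
have m0 : 0 < nrm m.
  rewrite lt_neqAle n0 andbT eq_sym; apply/eqP => /neq0 m0.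
  by move: Sm; rewrite inE /S /= m0 normr0 => /eqP; rewrite eq_sym oner_eq0.
exists (nrm m) => // x j.
have [->|xN0] := eqVneq x 0; first by rewrite mxE normr0 mulr0 n0.
have xp : 0 < `|x| by rewrite normr_gt0.
apply: (@le_trans _ _ (nrm m * `|x|)); first by rewrite ler_wpM2l// coord_le_norm.
rewrite -ler_pdivlMr//.
have := Hm (`|x|^-1 *: x); rewrite nZ normfV normr_id mulrC; apply.
by rewrite inE /S /= normrZ normfV normr_id mulVf ?normr_eq0.
Qed.

End torus_functions.

(** * Fejer-type sums and reduction of the error to frequencies *)

Section fejer.
Context {R : realType} {d : nat}.
Local Notation tm := (torus_measure R d).
Implicit Types f : 'rV[R]_d -> R[i].

Lemma binS_le_central K j : ('C(K.*2, K + j) <= 'C(K.*2, K))%N.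
Proof.
elim: j => [|j IH]; first by rewrite addn0.
apply: leq_trans IH; rewrite addnS.
have := mul_bin_left K.*2 (K + j) => e.
by rewrite -(leq_pmul2l (ltn0Sn (K + j))) e leq_mul2r; apply/orP; right; lia.
Qed.

Lemma kernel_coef_le1 K l : (l < K.*2.+1)%N -> kernel_coef K l <= 1 :> R.
Proof.
move=> lK; rewrite /kernel_coef ler_pdivrMr ?central_bin_gt0// mul1r ler_nat.
have [Kl|lK'] := leqP K l; first by rewrite -(subnKC Kl) binS_le_central.
rewrite -bin_sub; last by lia.
by rewrite (_ : (K.*2 - l = K + (K - l))%N) ?binS_le_central//; lia.
Qed.

(** The box [-K, K]^d is indexed by functions with values shifted by K, so that a product of
    one-dimensional sums expands over it by distributivity. *)
Definition freq K (phi : {ffun 'I_d -> 'I_(K.*2.+1)}) : 'rV[int]_d :=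
  \row_j ((phi j)%:Z - K%:Z).

Definition freq_coef K (phi : {ffun 'I_d -> 'I_(K.*2.+1)}) : R :=
  \prod_(j < d) kernel_coef K (phi j).

Definition dotp (k : 'rV[int]_d) (x : 'rV[R]_d) : R :=
  \sum_(j < d) (k 0 j)%:~R * x 0 j.

Lemma dotpD k (x y : 'rV[R]_d) : dotp k (x + y) = dotp k x + dotp k y.
Proof. by rewrite /dotp -big_split; apply: eq_bigr => j _; rewrite mxE mulrDr. Qed.

Lemma dotpZ k (a : R) (x : 'rV[R]_d) : dotp k (a *: x) = a * dotp k x.
Proof. by rewrite /dotp mulr_sumr; apply: eq_bigr => j _; rewrite mxE mulrCA. Qed.

Lemma freq_coef_itv K phi : 0 <= freq_coef (K := K) phi <= 1.
Proof.
apply/andP; split; first by apply: prodr_ge0 => j _; exact: kernel_coef_ge0.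
apply: prodr_ile1 => j _; rewrite kernel_coef_ge0 kernel_coef_le1//.
Qed.

Definition central_index K : {ffun 'I_d -> 'I_(K.*2.+1)} := [ffun=> inord K].

Lemma freq_eq0 K (phi : {ffun 'I_d -> 'I_(K.*2.+1)}) :
  (freq phi == 0) = (phi == central_index K).
Proof.
have hK : (K < K.*2.+1)%N by lia.
apply/eqP/eqP => [e|->].
  apply/ffunP => j; rewrite ffunE; apply/val_inj; rewrite /= inordK//.
  by have := congr1 (fun v : 'rV[int]_d => v 0 j) e; rewrite !mxE => /eqP; rewrite subr_eq0 => /eqP[].
by apply/rowP => j; rewrite !mxE ffunE inordK// subrr.
Qed.

Lemma freq_coef_central K : freq_coef (central_index K) = 1.
Proof.
apply: big1 => j _; rewrite ffunE inordK; last by lia.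
by rewrite kernel_coefK.
Qed.

Definition fejer_sum f K (x : 'rV[R]_d) : R[i] :=
  \sum_(phi : {ffun 'I_d -> 'I_(K.*2.+1)})
    (freq_coef phi)%:C * fourier_coef f (freq phi) * e2pi (dotp (freq phi) x).

Lemma cbmeas_torus_e2pi (k : 'rV[int]_d) :
  cbmeas (fun y : d.-tuple (measurableTypeR R) => e2pi (- dotp k (rv_of_tuple y))).
Proof.
have -> : (fun y : d.-tuple (measurableTypeR R) => e2pi (- dotp k (rv_of_tuple y))) =
   (fun y => \prod_(j < d) e2pi (- (k 0 j)%:~R * tnth y j)).
  apply/funext => y; rewrite -e2pi_sum -sumrN; congr e2pi.
  by apply: eq_bigr => j _; rewrite mxE mulNr.
apply: cbmeas_prod => j.
exact: (cbmeas_tnth j (cbmeas_e2pi_mul (- (k 0 j)%:~R))).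
Qed.

Lemma fejer_sumE f K (x : 'rV[R]_d) :
  cbmeas (fun y : d.-tuple (measurableTypeR R) => f (rv_of_tuple y)) ->
  fejer_sum f K x =
  Cint tm (fun y => f (rv_of_tuple y) * (kernel_prod K x y)%:C).
Proof.
move=> mf.
pose F (phi : {ffun 'I_d -> 'I_(K.*2.+1)}) (y : d.-tuple (measurableTypeR R)) :=
  f (rv_of_tuple y) * e2pi (- dotp (freq phi) (rv_of_tuple y)).
have mF phi : cbmeas (F phi) by apply: cbmeasM => //; exact: cbmeas_torus_e2pi.
pose c (phi : {ffun 'I_d -> 'I_(K.*2.+1)}) :=
  (freq_coef phi)%:C * e2pi (dotp (freq phi) x).
transitivity (Cint tm (fun y => \sum_phi c phi * F phi y)).
  rewrite Cint_sum; last by move=> phi; apply: cbmeasM => //; exact: cbmeas_cst.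
  by apply: eq_bigr => phi _; rewrite CintZ// mulrAC.
congr (Cint tm _); apply/funext => y.
have -> : (kernel_prod K x y)%:C = \prod_(j < d) \sum_(l < K.*2.+1)
    (kernel_coef K l)%:C * e2pi ((l%:Z - K%:Z)%:~R * (x 0 j - tnth y j)).
  by rewrite /kernel_prod rmorph_prod; apply: eq_bigr => j _; exact: kernelE.
rewrite bigA_distr_bigA /= mulr_sumr; apply: eq_bigr => phi _.
rewrite /c /F mulrCA; congr (_ * _).
rewrite big_split /= -rmorph_prod -mulrA -e2piD -e2pi_sum; congr (_ * e2pi _).
by rewrite -sumrN -big_split /=; apply: eq_bigr => j _; rewrite !mxE; ring.
Qed.

Section continuous_periodic.
Variable f : 'rV[R]_d -> R[i].
Hypothesis f_periodic : periodic_fun f.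
Hypothesis cRe : continuous (fun x => complex.Re (f x)).
Hypothesis cIm : continuous (fun x => complex.Im (f x)).

Let ReP y (k : 'rV[int]_d) : complex.Re (f (y + rv_of_int R k)) = complex.Re (f y).
Proof. by rewrite f_periodic. Qed.

Let ImP y (k : 'rV[int]_d) : complex.Im (f (y + rv_of_int R k)) = complex.Im (f y).
Proof. by rewrite f_periodic. Qed.

Lemma cbmeas_continuous_periodic :
  cbmeas (fun y : d.-tuple (measurableTypeR R) => f (rv_of_tuple y)).
Proof.
have [M HM] := periodic_bounded cRe ReP; have [M' HM'] := periodic_bounded cIm ImP.
split; split.
- exact: (measurable_continuous_torus cRe).
- by exists M => y; exact: HM.
- exact: (measurable_continuous_torus cIm).
- by exists M' => y; exact: HM'.
Qed.

Lemma fejer_sum_cvg (x : 'rV[R]_d) (e : R) : 0 < e ->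
  exists K0, forall K, (K0 <= K)%N -> normc (fejer_sum f K x - f x) <= e.
Proof.
move=> e0; have e2 : 0 < e / 2 by rewrite divr_gt0.
have [M HM] := periodic_bounded cRe ReP; have [M' HM'] := periodic_bounded cIm ImP.
have mf := cbmeas_continuous_periodic; have [mRe mIm] := mf.
have [K1 H1] := kernel_prod_approx ReP (@cRe x) HM mRe e2.
have [K2 H2] := kernel_prod_approx ImP (@cIm x) HM' mIm e2.
exists (maxn K1 K2) => K; rewrite geq_max => /andP[K1K K2K].
apply: le_trans (normc_le_ReIm _) _; rewrite fejer_sumE//.
rewrite (splitr e) lerD//.
  rewrite ReD /Cint /=; have := H1 K K1K.
  have -> : complex.Re (- f x) = - complex.Re (f x) by case: (f x).
  by under [in X in _ -> X]eq_Rintegral do rewrite ReM /= mulr0 subr0.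
rewrite ImD /Cint /=; have := H2 K K2K.
have -> : complex.Im (- f x) = - complex.Im (f x) by case: (f x).
by under [in X in _ -> X]eq_Rintegral do rewrite ImM /= mulr0 add0r.
Qed.

(** The super-analytic bound concerns large |k|; this crude one covers the remaining frequencies. *)
Lemma fourier_coef_bounded : exists2 M : R, 0 <= M &
  forall k : 'rV[int]_d, normc (fourier_coef f k) <= M.
Proof.
have [M HM] := periodic_bounded cRe ReP; have [M' HM'] := periodic_bounded cIm ImP.
have M0 : 0 <= M := le_trans (normr_ge0 _) (HM 0).
have M'0 : 0 <= M' := le_trans (normr_ge0 _) (HM' 0).
exists ((M + M') + (M + M')); first by rewrite !addr_ge0.
move=> k.
have [m1 m2] := cbmeasM cbmeas_continuous_periodic (cbmeas_torus_e2pi k).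
have bnd (g : d.-tuple (measurableTypeR R) -> R) B : bmeas g ->
    (forall y, `|g y| <= B) -> `|\int[tm]_y g y| <= B.
  move=> mg gB; apply: le_trans (Rint_normr _ mg) _.
  rewrite -[leRHS](Rint_cst tm); apply: Rint_le => //; last exact: bmeas_cst.
  have [mg1 [B1 HB1]] := mg; split; first exact: measurableT_comp.
  by exists B1 => y; rewrite normr_id.
have h (a b B : R) : `|a| <= B -> `|b| <= 1 -> `|a| * `|b| <= B.
  by move=> aB b1; rewrite -[B]mulr1 ler_pM.
apply: le_trans (normc_le_ReIm _) _; rewrite lerD//.
  apply: bnd => // y; rewrite ReM (le_trans (ler_normB _ _))// !normrM.
  by rewrite lerD// h// ?cos_max ?sin_max.
apply: bnd => // y; rewrite ImM (le_trans (ler_normD _ _))// !normrM.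
by rewrite lerD// h// ?cos_max ?sin_max.
Qed.

End continuous_periodic.

Lemma iter_rotation (rho theta : 'rV[R]_d) n : exists k : 'rV[int]_d,
  iter n (rotation rho) theta = theta + n%:R *: rho + rv_of_int R k.
Proof.
elim: n => [|n [k IH]].
  by exists 0; apply/rowP => j; rewrite /= !mxE mul0r !addr0.
exists (k - \row_j Num.floor ((iter n (rotation rho) theta) 0 j + rho 0 j)).
rewrite iterS; apply/rowP => j; rewrite !mxE rmorphB /=.
move: (Num.floor _)%:~R => w; rewrite IH !mxE -(natr1 n); ring.
Qed.

(** For fixed N, some K brings the Fejer-type sum within e of f at all N orbit points. Averaging
    against nonnegative weights of total mass 1 keeps the error below e, and e is arbitrary because
    [S] bounds the frequency sums for all K. *)
Lemma birkhoff_error_le f (p q m : R) (rho theta : 'rV[R]_d) (N : nat) (S : R) :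
  1 <= m -> m <= p -> m <= q -> (1 < N)%N ->
  periodic_fun f ->
  continuous (fun x => complex.Re (f x)) -> continuous (fun x => complex.Im (f x)) ->
  (forall K, \sum_(phi : {ffun 'I_d -> 'I_(K.*2.+1)} | freq phi != 0)
    normc (fourier_coef f (freq phi)) *
    ((bump_sum p q N)^-1 * normc (\sum_(n < N) (bump_ext p q 0 (n%:R / N%:R))%:C *
      e2pi (dotp (freq phi) rho) ^+ n)) <= S) ->
  birkhoff_error p q f rho theta N <= S.
Proof.
move=> m1 mp mq N1 fper cRe cIm HS.
rewrite /birkhoff_error (weighted_averageE m1 mp mq (fun n => f (iter n (rotation rho) theta))).
pose x n : 'rV[R]_d := theta + n%:R *: rho.
have fx n : f (iter n (rotation rho) theta) = f (x n).
  by have [k ->] := iter_rotation rho theta n; rewrite fper.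
under eq_bigr do rewrite fx.
set b := fun n : nat => bump_ext p q 0 (n%:R / N%:R).
have b0 n : 0 <= b n by have /andP[] := bump_ext0_le1 p q (n%:R / N%:R).
set A := bump_sum p q N.
have A0 : 0 < A := lt_le_trans (expR_gt0 _) (bump_sum_ge m1 mp mq N1).
apply/ler_addgt0Pr => e e0.
have [K HK] : exists K, forall n : 'I_N, normc (fejer_sum f K (x n) - f (x n)) <= e.
  have [K0 HK0] := boolp.choice (fun n => fejer_sum_cvg fper cRe cIm (x n) e0).
  exists (\max_(n < N) K0 n)%N => n; apply: HK0; exact: leq_bigmax.
pose T (g : 'rV[R]_d -> R[i]) := (A^-1)%:C * \sum_(n < N) (b n)%:C * g (x n).
have f0 : fourier_coef f 0 = torus_integral f.
  rewrite /fourier_coef; congr (torus_integral _); apply/funext => y.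
  by rewrite big1 ?oppr0 ?e2pi0 ?mulr1// => j _; rewrite mxE mul0r.
have -> : (A^-1)%:C * (\sum_(n < N) (b n)%:C * f (x n)) - torus_integral f =
    (T (fejer_sum f K) - fourier_coef f 0) +
    (A^-1)%:C * \sum_(n < N) (b n)%:C * (f (x n) - fejer_sum f K (x n)).
  under [X in _ = _ + _ * X]eq_bigr do rewrite mulrBr.
  by rewrite big_split /= sumrN f0 /T; ring.
apply: le_trans (le_normcD _ _) _; rewrite lerD//; last first.
  rewrite normcM normc_real ger0_norm ?invr_ge0 ?(ltW A0)//.
  rewrite mulrC ler_pdivrMr//.
  apply: le_trans (normc_sum _ _ _) _; rewrite /A /bump_sum mulr_sumr.
  apply: ler_sum => n _; rewrite normcM normc_real ger0_norm// mulrC.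
  rewrite ler_wpM2r// -normcN opprB; exact: HK.
apply: le_trans (HS K).
have -> : T (fejer_sum f K) = \sum_(phi : {ffun 'I_d -> 'I_(K.*2.+1)})
    (freq_coef phi)%:C * fourier_coef f (freq phi) * e2pi (dotp (freq phi) theta) *
    ((A^-1)%:C * \sum_(n < N) (b n)%:C * e2pi (dotp (freq phi) rho) ^+ n).
  rewrite /T /fejer_sum mulr_sumr.
  under eq_bigr do rewrite mulr_sumr mulr_sumr.
  rewrite exchange_big /=; apply: eq_bigr => phi _.
  rewrite !mulr_sumr; apply: eq_bigr => n _.
  by rewrite /x dotpD dotpZ e2piD e2pi_natmul; ring.
(* Frequency 0 has coefficient 1 and a weighted average equal to 1, so it cancels the integral of f
   exactly. *)
rewrite (bigD1 (central_index K))//=.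
have /eqP F0 : freq (central_index K) == 0 by rewrite freq_eq0.
have dot0 y : dotp 0 y = 0 by apply: big1 => j _; rewrite mxE mul0r.
rewrite freq_coef_central F0 !dot0 e2pi0 mul1r mulr1.
have -> : (A^-1)%:C * \sum_(n < N) (b n)%:C * 1 ^+ n = 1.
  under eq_bigr do rewrite expr1n mulr1.
  by rewrite -rmorph_sum -rmorphM mulVf// gt_eqF.
rewrite mulr1 addrAC subrr add0r.
under eq_bigl do rewrite -freq_eq0.
apply: le_trans (normc_sum _ _ _) _; apply: ler_sum => phi _.
rewrite !normcM normc_e2pi mulr1 !normc_real.
have /andP[c0 c1] := freq_coef_itv phi.
rewrite (ger0_norm c0) (@ger0_norm _ A^-1) ?invr_ge0 ?(ltW A0)//.
rewrite ler_wpM2r ?mulr_ge0 ?invr_ge0 ?normc_ge0 ?(ltW A0)//.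
by rewrite ler_piMl ?normc_ge0.
Qed.

End fejer.

(** * Small divisors *)

Section box_sums.
Context {R : realType}.

(** The induction carries the sharper bound 2 - 1 / (k + 1), which telescopes. *)
Lemma inv_squares_le2 n : \sum_(i < n) ((i.+1%:R : R) ^+ 2)^-1 <= 2.
Proof.
suff H k : \sum_(i < k.+1) ((i.+1%:R : R) ^+ 2)^-1 <= 2 - k.+1%:R^-1.
  case: n => [|n]; first by rewrite big_ord0.
  by apply: le_trans (H n) _; rewrite gerBl invr_ge0.
elim: k => [|k IH]; first by rewrite big_ord1 expr1n invr1; lra.
rewrite big_ord_recr /=; apply: le_trans (lerD IH (lexx _)) _.
have k0 : 0 < k.+1%:R :> R by [].
rewrite -(natr1 k.+1); move: (k.+1%:R : R) k0 => u u0; have u1 : 0 < u + 1 by lra.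
rewrite -subr_ge0 (_ : _ - _ = (u * (u + 1) ^+ 2)^-1); first by rewrite invr_ge0 mulr_ge0 ?exprn_ge0// ltW.
by field; rewrite !gt_eqF.
Qed.

Lemma centered_inv_squares_le4 K :
  \sum_(l < K.*2.+1) ((1 + `|l%:Z - K%:Z|%N)%:R ^+ 2)^-1 <= 4 :> R.
Proof.
pose g (n : nat) : R := (n.+1%:R ^+ 2)^-1.
have g0 n : 0 <= g n by rewrite invr_ge0 exprn_ge0.
have gs n : \sum_(0 <= i < n) g i <= 2 by rewrite big_mkord inv_squares_le2.
rewrite -(big_mkord xpredT (fun l => ((1 + `|l%:Z - K%:Z|%N)%:R ^+ 2)^-1)).
rewrite (big_cat_nat _ (n := K))//=; last by lia.
rewrite (_ : 4 = 2 + 2 :> R); last by ring.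
rewrite lerD//.
  rewrite big_nat_rev /= add0n.
  apply: le_trans (_ : \sum_(0 <= i < K) g i.+1 <= _).
    rewrite le_eqVlt; apply/orP; left; apply/eqP; apply: eq_big_nat => i iK.
    by rewrite /g; congr ((_%:R ^+ 2)^-1); lia.
  have := gs K.+1; rewrite big_nat_recl//; apply: le_trans.
  by rewrite lerDr.
rewrite -{1}[K]add0n big_addn.
apply: le_trans (gs (K.*2.+1 - K)%N).
rewrite le_eqVlt; apply/orP; left; apply/eqP; apply: eq_big_nat => i iK.
by rewrite /g; congr ((_%:R ^+ 2)^-1); lia.
Qed.

Definition wt d (k : 'rV[int]_d) : nat := \prod_(j < d) (1 + `|k 0%R j|%N).

Lemma wt_gt0 d (k : 'rV[int]_d) : (0 < wt k)%N.
Proof. by rewrite prodn_gt0. Qed.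

Lemma box_sum_le d K :
  \sum_(phi : {ffun 'I_d -> 'I_(K.*2.+1)}) ((wt (freq phi))%:R ^+ 2)^-1 <= 4 ^+ d :> R.
Proof.
have -> : \sum_(phi : {ffun 'I_d -> 'I_(K.*2.+1)}) ((wt (freq phi))%:R ^+ 2)^-1 =
    \prod_(j < d) \sum_(l < K.*2.+1) (((1 + `|l%:Z - K%:Z|%N)%:R : R) ^+ 2)^-1.
  rewrite bigA_distr_bigA; apply: eq_bigr => phi _.
  rewrite /wt natr_prod -prodrXl -prodfV; apply: eq_bigr => j _.
  by rewrite mxE.
rewrite -[leRHS]/(4 ^+ d) -[d in leRHS]card_ord -prodr_const.
apply: ler_prod => j _; rewrite centered_inv_squares_le4 andbT.
by apply: sumr_ge0 => l _; rewrite invr_ge0 exprn_ge0.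
Qed.

End box_sums.

Section diophantine.
Context {R : realType} {d : nat}.
Local Notation tm := (torus_measure R d).

(** Passing from K to K + 1 multiplies the left side by (2 K + 1) (2 K + 3) / (2 K + 2)^2 < 1. It
    says that the mean of cos^(2 K) is at most (2 K + 1)^(-1/2). *)
Lemma wallis_bound K : ('C(K.*2, K)%:R / 4 ^+ K) ^+ 2 * K.*2.+1%:R <= 1 :> R.
Proof.
elim: K => [|K IH]; first by rewrite bin0 expr0 divr1 expr1n mul1r.
apply: le_trans IH.
have c0 : 'C(K.*2, K)%:R != 0 :> R by rewrite gt_eqF ?central_bin_gt0.
have k0 : 0 < K%:R + 1 :> R by rewrite ltr_wpDl.
have e : 'C(K.+1.*2, K.+1)%:R = 2 * (2 * K%:R + 1) * 'C(K.*2, K)%:R / (K%:R + 1) :> R.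
  have := congr1 (fun n => n%:R : R) (central_binS K).
  rewrite /= !natrM -[K.*2.+1%:R]natr1 -[K.*2]mul2n natrM -[K.+1%:R]natr1 => e.
  by rewrite -[X in X / _]mulrA -e; field; rewrite gt_eqF.
have -> : K.+1.*2.+1%:R = 2 * K%:R + 3 :> R by rewrite -addn1 -mul2n natrD natrM -natr1; ring.
have -> : K.*2.+1%:R = 2 * K%:R + 1 :> R by rewrite -natr1 -mul2n natrM.
rewrite e (exprSr 4 K).
have f0 : 4 ^+ K != 0 :> R by rewrite expf_neq0.
move: ('C(K.*2, K)%:R) (4 ^+ K) c0 f0 (K%:R : R) k0 (ler0n R K) => c f c0 f0 u u1 u0.
rewrite -subr_ge0 (_ : _ - _ = (c / f) ^+ 2 * (2 * u + 1) / (4 * (u + 1) ^+ 2)).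
  apply: divr_ge0; first by apply: mulr_ge0; [exact: sqr_ge0|lra].
  by apply: mulr_ge0; [lra|exact: sqr_ge0].
by field; rewrite f0 gt_eqF.
Qed.

(** As k is nonzero, the frequency (l - K) k vanishes only for l = K, so the mean does not depend on
    k. *)
Lemma Rint_kernel_dotp (k : 'rV[int]_d) K : k != 0 ->
  \int[tm]_y kernel K (dotp k (rv_of_tuple y)) = 1.
Proof.
move=> k0.
suff : (\int[tm]_y kernel K (dotp k (rv_of_tuple y)))%:C = 1 :> R[i] by case.
rewrite -Cint_real.
have E (l : nat) (y : d.-tuple (measurableTypeR R)) :
    e2pi ((l%:Z - K%:Z)%:~R * dotp k (rv_of_tuple y)) =
    e2pi (\sum_(j < d) (((l%:Z - K%:Z) *: k : 'rV[int]_d) 0 j)%:~R * tnth y j).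
  congr e2pi; rewrite /dotp mulr_sumr; apply: eq_bigr => j _.
  by rewrite !mxE rmorphM /= mulrA.
have -> : (fun y : d.-tuple (measurableTypeR R) => (kernel K (dotp k (rv_of_tuple y)))%:C) =
    (fun y => \sum_(l < K.*2.+1)
    (kernel_coef K l)%:C * e2pi (\sum_(j < d) (((l%:Z - K%:Z) *: k : 'rV[int]_d) 0 j)%:~R * tnth y j)).
  apply/funext => y; rewrite kernelE; apply: eq_bigr => l _.
  by rewrite -E.
have mE (k' : 'rV[int]_d) : cbmeas (fun y : d.-tuple (measurableTypeR R) =>
    e2pi (\sum_(j < d) (k' 0 j)%:~R * tnth y j)).
  under eq_fun do rewrite e2pi_sum.
  apply: cbmeas_prod => j; exact: (cbmeas_tnth j (cbmeas_e2pi_mul (k' 0 j)%:~R)).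
rewrite Cint_sum; last by move=> l; apply: cbmeasM; [exact: cbmeas_cst|exact: mE].
have hK : (K < K.*2.+1)%N by lia.
rewrite (bigD1 (Ordinal hK))//= big1 ?addr0 => [|l lK].
  by rewrite CintZ ?Cint_torus_e2pi// subrr scale0r eqxx mulr1 kernel_coefK.
rewrite CintZ ?Cint_torus_e2pi// scalemx_eq0 (negbTE k0) orbF subr_eq0 eqz_nat.
rewrite (_ : l == K :> nat = false) ?mulr0//; apply/negbTE.
by apply: contra lK => /eqP lK; apply/eqP/val_inj.
Qed.

Lemma cbmeas_e2pi_dotp (k : 'rV[int]_d) :
  cbmeas (fun y : d.-tuple (measurableTypeR R) => e2pi (dotp k (rv_of_tuple y))).
Proof.
have := cbmeas_torus_e2pi (R := R) (- k); congr cbmeas; apply/funext => y.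
by rewrite /dotp -sumrN; congr e2pi; apply: eq_bigr => j _; rewrite !mxE rmorphN mulNr opprK.
Qed.

Lemma bmeas_kernel_dotp (k : 'rV[int]_d) K :
  bmeas (fun y : d.-tuple (measurableTypeR R) => kernel K (dotp k (rv_of_tuple y))).
Proof.
have mF (l : 'I_K.*2.+1) : cbmeas (fun y : d.-tuple (measurableTypeR R) =>
    (kernel_coef K l)%:C * e2pi ((l%:Z - K%:Z)%:~R * dotp k (rv_of_tuple y))).
  apply: cbmeasM; first exact: cbmeas_cst.
  have := cbmeas_e2pi_dotp ((l%:Z - K%:Z) *: k); congr cbmeas; apply/funext => y.
  congr e2pi; rewrite /dotp mulr_sumr; apply: eq_bigr => j _.
  by rewrite !mxE rmorphM /= mulrA.
have [+ _] := cbmeas_sum (index_enum _) mF.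
by congr bmeas; apply/funext => y; rewrite -kernelE.
Qed.

(** The threshold is 1 / (2 K) with K = J^2 W(k)^4, the order of the kernel that serves as
    majorant. *)
Definition resonance (J : nat) (k : 'rV[int]_d) : set (d.-tuple (measurableTypeR R)) :=
  [set y | sin (pi * dotp k (rv_of_tuple y)) ^+ 2 <= (2 * (J ^ 2 * wt k ^ 4)%:R)^-1].

Lemma measurable_resonance J k : measurable (resonance J k).
Proof.
have [mRe _] := cbmeas_e2pi_dotp k.
have mf : measurable_fun setT (fun y : d.-tuple (measurableTypeR R) =>
    sin (pi * dotp k (rv_of_tuple y)) ^+ 2).
  have -> : (fun y : d.-tuple (measurableTypeR R) => sin (pi * dotp k (rv_of_tuple y)) ^+ 2) =
     (fun y => 2^-1 * (1 - complex.Re (e2pi (dotp k (rv_of_tuple y))))).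
    apply/funext => y; rewrite /e2pi /=.
    rewrite -mulrA mulr_natl cos_mulr2n sin2cos2.
    by set c := cos _ ^+ 2; rewrite -(mulr_natl c); field.
  by have [] := bmeasZ 2^-1 (bmeasB (bmeas_cst 1) mRe).
have := mf measurableT `]-oo, (2 * (J ^ 2 * wt k ^ 4)%:R)^-1]%classic (measurable_itv _).
by rewrite setTI; congr measurable.
Qed.

Lemma bernoulli_le (t : R) n : 0 <= t <= 1 -> 1 - n%:R * t <= (1 - t) ^+ n.
Proof.
move=> /andP[t0 t1]; elim: n => [|n IH]; first by rewrite mul0r subr0.
rewrite exprS; apply: le_trans (_ : (1 - t) * (1 - n%:R * t) <= _).
  have n0 : 0 <= n%:R :> R by [].
  by rewrite -(natr1 n); nra.
by rewrite ler_wpM2l// subr_ge0.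
Qed.

(** On the set, cos^(2 K) >= (1 - 1 / (2 K))^K >= 1/2 by Bernoulli, while the normalization of the
    kernel is at least K^(1/2) = J W(k)^2 by the Wallis bound. Integrating, as in the Markov
    inequality, bounds the measure by 2 / (J W(k)^2). *)
Lemma resonance_indic_le (J : nat) (k : 'rV[int]_d) y : (0 < J)%N ->
  resonance J k y ->
  1 <= 2 / (J%:R * (wt k)%:R ^+ 2) *
    kernel (J ^ 2 * wt k ^ 4) (dotp k (rv_of_tuple y)).
Proof.
rewrite /resonance /=; set K := (J ^ 2 * wt k ^ 4)%N; set t := dotp _ _ => J0 H.
have K0 : (0 < K)%N by rewrite muln_gt0 !expn_gt0 J0 wt_gt0.
have KR : 0 < K%:R :> R by rewrite ltr0n.
have J0' : 0 < J%:R :> R by rewrite ltr0n.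
have w0 : 0 < (wt k)%:R :> R by rewrite ltr0n wt_gt0.
pose u : R := 'C(K.*2, K)%:R / 4 ^+ K.
have u0 : 0 < u by rewrite divr_gt0 ?central_bin_gt0// exprn_gt0.
pose D : R := J%:R * (wt k)%:R ^+ 2.
have D0 : 0 < D by rewrite mulr_gt0// exprn_gt0.
have DK : D ^+ 2 = K%:R by rewrite /D /K natrM !natrX exprMn -exprM.
have uD : u <= D^-1.
  rewrite -(@ler_pXn2r _ 2) ?nnegrE ?invr_ge0 ?(ltW u0) ?(ltW D0)//.
  rewrite exprVn DK -[leRHS]mul1r ler_pdivlMr//.
  apply: le_trans (wallis_bound K); rewrite -/u ler_wpM2l ?sqr_ge0// ler_nat; lia.
have kE : u * kernel K t = (cos (pi * t) ^+ 2) ^+ K.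
  rewrite /u /kernel -exprM mul2n mulrA.
  by rewrite (_ : _ / _ * (_ / _) = 1) ?mul1r//; field; rewrite gt_eqF ?central_bin_gt0//= expf_neq0.
have half : 2^-1 <= u * kernel K t.
  rewrite kE cos2sin2.
  apply: (@le_trans _ _ ((1 - (2 * K%:R)^-1) ^+ K)); last first.
    rewrite lerXn2r ?nnegrE ?lerD2l ?lerN2//.
    rewrite subr_ge0 invf_le1 ?mulr_gt0//.
    by rewrite -natrM ler1n; lia.
  apply: le_trans (bernoulli_le K _).
    by rewrite (_ : 1 - _ = 2^-1)//; field; rewrite gt_eqF.
  apply/andP; split; first by rewrite invr_ge0 mulr_ge0.
  by rewrite invf_le1 ?mulr_gt0// -natrM ler1n; lia.
have k0 := kernel_ge0 K t.
rewrite -/D -mulrA; have : u * kernel K t <= D^-1 * kernel K t by rewrite ler_wpM2r.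
lra.
Qed.

Lemma freq_surj K (k : 'rV[int]_d) : (forall j, (`|k 0%R j|%N <= K)%N) ->
  exists phi : {ffun 'I_d -> 'I_(K.*2.+1)}, freq phi = k.
Proof.
move=> kK; exists [ffun j => inord (absz (k 0 j + K%:Z))].
apply/rowP => j; rewrite !mxE ffunE inordK; last by have := kK j; lia.
by have := kK j; lia.
Qed.

Definition resonant_box (J B : nat) : set (d.-tuple (measurableTypeR R)) :=
  \bigcup_(k in [set k : 'rV[int]_d | k != 0 /\ forall j, (`|k 0%R j|%N <= B)%N])
    resonance J k.

Lemma measurable_resonant_box J B : measurable (resonant_box J B).
Proof.
rewrite /resonant_box bigcup_mkcond; apply: countable_bigcupT_measurable => // k.
by case: ifP => // _; exact: measurable_resonance.
Qed.

(** The bound does not involve B, so it survives the increasing union over all boxes. *)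
Lemma resonant_box_le J B : (0 < J)%N ->
  (tm (resonant_box J B) <= (2 * 4 ^+ d / J%:R)%:E)%E.
Proof.
move=> J0.
have mE := measurable_resonant_box J B.
have Efin : tm (resonant_box J B) \is a fin_num by exact: fin_num_measure.
rewrite -(fineK Efin) lee_fin.
have mi : bmeas (\1_(resonant_box J B) : d.-tuple (measurableTypeR R) -> R).
  split; first exact: measurable_indic.
  by exists 1 => y; rewrite indicE; case: (_ \in _); rewrite ?normr1 ?normr0.
have -> : fine (tm (resonant_box J B)) = \int[tm]_y \1_(resonant_box J B) y.
  by rewrite /Rintegral integral_indic// setIT.
pose h (phi : {ffun 'I_d -> 'I_(B.*2.+1)}) (y : d.-tuple (measurableTypeR R)) : R :=
  2 / (J%:R * (wt (freq phi))%:R ^+ 2) *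
    kernel (J ^ 2 * wt (freq phi) ^ 4) (dotp (freq phi) (rv_of_tuple y)).
have mh phi : bmeas (h phi) by apply: bmeasZ; exact: bmeas_kernel_dotp.
have h0 phi y : 0 <= h phi y.
  by rewrite mulr_ge0 ?kernel_ge0// divr_ge0// mulr_ge0// exprn_ge0.
apply: (@le_trans _ _ (\int[tm]_y \sum_(phi | freq phi != 0) h phi y)).
  apply: Rint_le => //; first exact: bmeas_sum.
  move=> y; rewrite indicE; case: (boolP (y \in _)) => [|_]; last first.
    by apply: sumr_ge0 => phi _; exact: h0.
  rewrite inE => -[k [/= k0 kB] res].
  have [phi phik] := freq_surj kB.
  rewrite (bigD1 phi)/=; last by rewrite phik.
  rewrite -[leLHS]addr0 lerD//; last by apply: sumr_ge0 => psi _; exact: h0.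
  by rewrite /h phik; exact: resonance_indic_le.
rewrite Rint_sum//.
apply: (@le_trans _ _ (\sum_(phi : {ffun 'I_d -> 'I_(B.*2.+1)})
    2 / J%:R * ((wt (freq phi))%:R ^+ 2)^-1)).
  rewrite [leRHS](bigID (fun phi => freq phi != 0)) /= -[leLHS]addr0 lerD//; last first.
    by apply: sumr_ge0 => phi _; rewrite mulr_ge0 ?divr_ge0// invr_ge0 exprn_ge0.
  apply: ler_sum => phi phi0.
  rewrite /h RintZ ?Rint_kernel_dotp// ?mulr1 ?invfM ?mulrA//.
  exact: bmeas_kernel_dotp.
rewrite -mulr_sumr mulrAC ler_wpM2r ?invr_ge0//.
by rewrite ler_wpM2l// box_sum_le.
Qed.

(** The exceptional rotations lie in every E_J, of measure O(1 / (J + 1)), hence form a null set.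
    Outside E_J, gamma = 1 / (J + 1) serves all k at once. *)
Lemma diophantine_ae :
  {ae tm, forall y, exists2 gamma : R, 0 < gamma &
    forall k : 'rV[int]_d, k != 0 ->
      gamma / (wt k)%:R ^+ 2 <= normc (1 - e2pi (dotp k (rv_of_tuple y)))}.
Proof.
pose E J := \bigcup_B resonant_box J.+1 B.
have mE J : measurable (E J).
  by apply: bigcupT_measurable => B; exact: measurable_resonant_box.
have muE J : (tm (E J) <= (2 * 4 ^+ d / J.+1%:R)%:E)%E.
  have cv : tm (resonant_box J.+1 B) @[B --> \oo] --> tm (E J).
    apply: nondecreasing_cvg_mu; [|exact: mE|].
      by move=> B; exact: measurable_resonant_box.
    move=> B C BC; apply/subsetPset => y [k [k0 kB] res]; exists k => //.
    by split => // j; exact: leq_trans (kB j) BC.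
  rewrite -(cvg_lim _ cv)//; apply: lime_le; first by apply/cvg_ex; exists (tm (E J)).
  by apply: nearW => B; exact: resonant_box_le.
exists (\bigcap_J E J); split.
- exact: bigcapT_measurable.
- apply/eqP; rewrite eq_le measure_ge0 andbT.
  apply/lee_addgt0Pr => e e0; rewrite add0e.
  pose J := Num.bound (e^-1 * (2 * 4 ^+ d)).
  apply: (@le_trans _ _ (tm (E J))).
    by apply: le_measure; rewrite ?inE//; [exact: bigcapT_measurable|exact: bigcap_inf].
  apply: le_trans (muE J) _; rewrite lee_fin ler_pdivrMr// -ler_pdivrMl//.
  apply: ltW; apply: (@lt_le_trans _ _ J%:R); last by rewrite ler_nat.
  by apply: archi_boundP; rewrite mulr_ge0 ?invr_ge0 ?(ltW e0)// mulr_ge0// exprn_ge0.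
- move=> y /= H; apply: contrapT => nE; apply: H.
  have [J nEJ] : exists J, ~ E J y.
    by apply/existsNP => HE; apply: nE => J _; exact: HE.
  exists J.+1%:R^-1 => [|k k0]; first by rewrite invr_gt0.
  rewrite leNgt; apply/negP => small; apply: nEJ.
  exists (\max_(j < d) `|k 0%R j|%N)%N => //.
  exists k => /=.
    by split => // j; exact: leq_bigmax.
  rewrite /resonance /=; set t := dotp _ _ in small *.
  have w0 : 0 < (wt k)%:R :> R by rewrite ltr0n wt_gt0.
  (* A divisor below gamma / W(k)^2 gives sin^2 at most a quarter of 1 / ((J + 1)^2 W(k)^4), under
     the resonance threshold, which is half of it. *)
  have : normc (1 - e2pi t) ^+ 2 <= (J.+1%:R^-1 / (wt k)%:R ^+ 2) ^+ 2.
    by rewrite lerXn2r ?nnegrE ?normc_ge0 ?divr_ge0 ?exprn_ge0 ?invr_ge0 ?(ltW w0)// ltW.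
  rewrite normc_1Be2pi.
  have -> : (J.+1%:R^-1 / (wt k)%:R ^+ 2) ^+ 2 = ((J.+1 ^ 2 * wt k ^ 4)%:R)^-1 :> R.
    by rewrite -invfM exprVn natrM !natrX exprMn -exprM.
  rewrite invfM; have : 0 <= ((J.+1 ^ 2 * wt k ^ 4)%:R)^-1 :> R by rewrite invr_ge0.
  move: (_%:R^-1) (sin _ ^+ 2) => I s; lra.
Qed.

End diophantine.

(** * Decay of the error term *)

Section decay.
Context {R : realType}.

(** With n = max |k_j|, W(k) <= (n + 1)^d. As k is nonzero, n + 1 <= 2 n, whence the factor 1/2 in
    the constant. *)
Lemma norm_ge_wt d (nrm : 'rV[R]_d -> R) : (0 < d)%N -> is_norm nrm ->
  exists2 c, 0 < c & forall k : 'rV[int]_d, k != 0 ->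
    c * (wt k)%:R `^ d%:R^-1 <= nrm (rv_of_int R k).
Proof.
move=> d0 /is_norm_lower_bound[c c0 Hc].
exists (c / 2) => [|k k0]; first by rewrite divr_gt0.
have dR : 0 < d%:R :> R by rewrite ltr0n.
pose n := (\max_(j < d) `|k 0%R j|%N)%N.
have Id : (0 < #|'I_d|)%N by rewrite card_ord.
have [j0 nj0] : {j0 | n = `|k 0%R j0|%N} by exact: bigop.eq_bigmax.
have n0 : (0 < n)%N.
  rewrite lt0n; apply: contra k0 => /eqP n0; apply/eqP/rowP => j; rewrite mxE.
  have : (`|k 0%R j| <= n)%N by exact: leq_bigmax.
  by rewrite n0 leqn0 absz_eq0 => /eqP ->.
have wn : (wt k <= n.+1 ^ d)%N.
  rewrite /wt -[d in (_ ^ d)%N]card_ord -prod_nat_const.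
  by apply: leq_prod => j _; rewrite add1n ltnS; exact: leq_bigmax.
have wr : (wt k)%:R `^ d%:R^-1 <= n.+1%:R :> R.
  apply: (@le_trans _ _ ((n.+1%:R ^+ d) `^ d%:R^-1)).
    apply: ge0_ler_powR; rewrite ?invr_ge0 ?nnegrE ?exprn_ge0//.
    by rewrite -natrX ler_nat.
  by rewrite -powR_mulrn// -powRrM divff ?gt_eqF// powRr1.
apply: le_trans (Hc (rv_of_int R k) j0); rewrite mxE -intr_norm.
have -> : `|k 0 j0|%R = n%:Z by rewrite nj0 abszE.
have : n.+1%:R <= 2 * n%:R :> R by rewrite -natrM ler_nat; lia.
rewrite [_%:~R]/=; move: (_ `^ _) wr => u un n2; nra.
Qed.

Lemma fourier_coef_decay d (nrm : 'rV[R]_d -> R) (f : 'rV[R]_d -> R[i]) (w : R) :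
  (0 < d)%N -> is_norm nrm -> periodic_fun f ->
  continuous (fun x => complex.Re (f x)) -> continuous (fun x => complex.Im (f x)) ->
  super_analytic nrm f -> 1 < w ->
  exists C c : R, [/\ 0 <= C, 0 < c & forall k : 'rV[int]_d, k != 0 ->
    normc (fourier_coef f k) <= C * expR (- (c * (wt k)%:R `^ w))].
Proof.
move=> d0 Hn fper cRe cIm fsa w1.
have dR : 1 <= d%:R :> R by rewrite ler1n.
(* The exponent v = d w turns |k|^v into a multiple of W(k)^w. *)
have v1 : 1 < d%:R * w by nra.
have [C0 [M HM]] := fsa _ v1.
have [B B0 HB] := fourier_coef_bounded fper cRe cIm.
have [c c0 Hc] := norm_ge_wt d0 Hn.
have nrm0 x : 0 <= nrm x by case: Hn.
set v := d%:R * w in v1 HM.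
(* The second summand covers the k with norm below M, where exp (|M|^v) compensates exp (-
   |k|^v). *)
exists (`|C0| + B * expR (`|M| `^ v)), (c `^ v); split.
- by rewrite addr_ge0// mulr_ge0// expR_ge0.
- by rewrite powR_gt0.
move=> k k0.
apply: (@le_trans _ _ ((`|C0| + B * expR (`|M| `^ v)) * expR (- nrm (rv_of_int R k) `^ v))).
  rewrite mulrDl; have [Mn|nM] := lerP M (nrm (rv_of_int R k)).
    apply: le_trans (HM _ Mn) _; rewrite -[leLHS]addr0 lerD//.
      by rewrite ler_wpM2r ?expR_ge0// ler_norm.
    by rewrite !mulr_ge0 ?expR_ge0.
  apply: le_trans (HB k) _; rewrite -[leLHS]add0r lerD ?mulr_ge0 ?expR_ge0//.
  rewrite -mulrA -expRD ler_peMr// -expR0 ler_expR subr_ge0.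
  apply: ge0_ler_powR; rewrite ?nnegrE//; first by lra.
  by rewrite (le_trans (ltW nM))// ler_norm.
rewrite ler_wpM2l//; first by rewrite addr_ge0// mulr_ge0// expR_ge0.
rewrite ler_expR lerN2.
have -> : c `^ v * (wt k)%:R `^ w = (c * (wt k)%:R `^ d%:R^-1) `^ v.
  rewrite powRM ?powR_ge0 ?(ltW c0)//; congr (_ * _).
  by rewrite -powRrM /v mulrA mulVf ?mul1r// gt_eqF// (lt_le_trans ltr01).
apply: ge0_ler_powR; rewrite ?nnegrE ?mulr_ge0 ?powR_ge0 ?(ltW c0)//; first by lra.
exact: Hc.
Qed.

Lemma weighted_sum_le1 (p q m : R) (N : nat) (z : R[i]) :
  1 <= m -> m <= p -> m <= q -> (1 < N)%N -> normc z = 1 ->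
  (bump_sum p q N)^-1 *
    normc (\sum_(n < N) (bump_ext p q 0 (n%:R / N%:R))%:C * z ^+ n) <= 1.
Proof.
move=> m1 mp mq N1 z1.
have A0 : 0 < bump_sum p q N := lt_le_trans (expR_gt0 _) (bump_sum_ge m1 mp mq N1).
rewrite mulrC ler_pdivrMr// mul1r.
apply: le_trans (normc_sum _ _ _) _; apply: ler_sum => n _.
rewrite normcM normcX z1 expr1n mulr1 normc_real ger0_norm//.
by have /andP[] := bump_ext0_le1 p q (n%:R / N%:R).
Qed.

(** For an integer j above 1 / a, N <= (N^a)^j <= j^j exp (N^a). *)
Lemma linear_le_expR_powR (a : R) : 0 < a ->
  exists2 C : R, 0 <= C & forall N : nat, (0 < N)%N -> N%:R <= C * expR (N%:R `^ a).
Proof.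
move=> a0; pose j := (Num.bound a^-1).+1.
exists (j%:R ^+ j); first by rewrite exprn_ge0.
move=> N N0.
have N1 : 1 <= N%:R :> R by rewrite ler1n.
apply: le_trans (exprn_le_expR (j := j) isT (powR_ge0 _ _)).
rewrite -powR_mulrn ?powR_ge0// -powRrM.
rewrite -[leLHS]powRr1//; apply: ler_powR => //.
rewrite -ler_pdivrMl// mulr1; apply: ltW.
apply: (@lt_le_trans _ _ (Num.bound a^-1)%:R); last by rewrite ler_nat.
by apply: archi_boundP; rewrite invr_ge0 ltW.
Qed.

Lemma powR_ge_eventually (s M : R) : 0 < s ->
  exists N0, forall N : nat, (N0 <= N)%N -> M <= N%:R `^ s.
Proof.
move=> s0; exists (Num.bound (`|M| `^ s^-1)) => N HN.
apply: le_trans (ler_norm M) _.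
have -> : `|M| = (`|M| `^ s^-1) `^ s by rewrite -powRrM mulVf ?gt_eqF// powRr1.
apply: ge0_ler_powR; rewrite ?nnegrE ?powR_ge0// ?(ltW s0)//.
apply: ltW; apply: (@lt_le_trans _ _ (Num.bound (`|M| `^ s^-1))%:R); last by rewrite ler_nat.
by apply: archi_boundP; exact: powR_ge0.
Qed.

(* The order [L] of the repeated summation by parts is chosen close to [N^a]. *)
Lemma weighted_sum_decay (p q m a eps gamma : R) :
  1 <= m -> m <= p -> m <= q -> 0 < a < 1 -> 0 < gamma ->
  a * (1 + m^-1) + eps < 1 ->
  exists2 C : R, 0 <= C & exists N0 : nat, forall N : nat, (N0 <= N)%N ->
  forall z : R[i], normc z = 1 -> gamma * N%:R `^ (- eps) <= normc (1 - z) ->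
  (bump_sum p q N)^-1 *
    normc (\sum_(n < N) (bump_ext p q 0 (n%:R / N%:R))%:C * z ^+ n) <=
  C * expR (- N%:R `^ a).
Proof.
move=> m1 mp mq /andP[a0 a1] g0 hexp.
(* The quantity raised to the power L is at most D N^-s, where the 8 in [D] comes from 4 L <= 4 (N^a
   + 1) <= 8 N^a. Once N^s >= D e^2 it is at most e^-2, so its L-th power is at most exp (- 2 N^a),
   half of which absorbs a factor N. *)
pose s := 1 - (a * (1 + m^-1) + eps); have s0 : 0 < s by rewrite /s; lra.
pose D := (p + q + 1) * 8 `^ (1 + m^-1) / gamma.
have D0 : 0 <= D by rewrite !mulr_ge0 ?powR_ge0 ?invr_ge0 ?(ltW g0)//; lra.
have [N1 HN1] := powR_ge_eventually (D * expR 2) s0.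
have [Cj Cj0 HCj] := linear_le_expR_powR a0.
have f0 : 0 < bump_floor p q by exact: expR_gt0.
exists ((bump_floor p q)^-1 * (4 * Cj)); first by rewrite !mulr_ge0 ?invr_ge0 ?(ltW f0).
exists (maxn 2 N1) => N; rewrite geq_max => /andP[N2 NN1] z z1 hz.
have NR : 1 <= N%:R :> R by rewrite ler1n ltnW.
have N0 : 0 < N%:R :> R by lra.
have Na1 : 1 <= N%:R `^ a.
  by apply: (@le_trans _ _ (N%:R `^ 0)); [rewrite powRr0 | rewrite ler_powR// ltW].
have NaN : N%:R `^ a <= N%:R by apply: ler1_powR => //; exact: ltW.
have [L L1 L2] : exists2 L : nat, N%:R `^ a <= L%:R & L%:R <= N%:R `^ a + 1.
  exists `|Num.ceil (N%:R `^ a)|%N; rewrite natr_absz ger0_norm ?ceil_ge.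
  - by [].
  - by rewrite ceil_ge0 (lt_le_trans _ (powR_ge0 _ _))// ltrN10.
  - by have := ceilB1_lt (N%:R `^ a); rewrite rmorphB /=; lra.
  - by rewrite ceil_ge0 (lt_le_trans _ (powR_ge0 _ _))// ltrN10.
have m0 : 0 <= m^-1 by rewrite invr_ge0; lra.
have L0 : (0 < L)%N by rewrite -(ltr0n R); lra.
have N00 : (0 < N)%N by exact: ltnW.
have eta0 : 0 < gamma * N%:R `^ (- eps) by rewrite mulr_gt0// powR_gt0.
have ratio : (p + q + 1) * (4 * L%:R) `^ (1 + m^-1) / (N%:R * (gamma * N%:R `^ (- eps))) <= expR (- 2).
  apply: (@le_trans _ _ (D * N%:R `^ (- s))).
    have -> : D * N%:R `^ (- s) = (p + q + 1) * (8 * N%:R `^ a) `^ (1 + m^-1) /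
        (N%:R * (gamma * N%:R `^ (- eps))).
      rewrite powRM ?powR_ge0// -powRrM.
      have -> : N%:R `^ (- s) = N%:R `^ (a * (1 + m^-1)) / (N%:R * N%:R `^ (- eps)).
        have -> : N%:R * N%:R `^ (- eps) = N%:R `^ (1 - eps).
          by rewrite powRD ?(gt_eqF N0) ?implybT// powRr1 ?(ltW N0).
        by rewrite -powRB ?(gt_eqF N0) ?implybT//; congr (_ `^ _); rewrite /s; ring.
      have e0 : N%:R `^ (- eps) != 0 by rewrite gt_eqF// powR_gt0.
      by rewrite /D; field; rewrite e0 (gt_eqF N0) (gt_eqF g0).
    rewrite ler_wpM2r ?invr_ge0 ?mulr_ge0 ?powR_ge0 ?(ltW N0) ?(ltW g0)//.
    rewrite ler_wpM2l//; first by lra.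
    by apply: ge0_ler_powR; rewrite ?nnegrE ?mulr_ge0 ?powR_ge0//; lra.
  rewrite powRN expRN ler_pdivrMr ?powR_gt0// mulrC ler_pdivlMr ?expR_gt0//.
  exact: HN1.
have NL : (N + L).+1%:R <= 4 * N%:R :> R.
  by rewrite -addn1 !natrD; move: (N%:R `^ a) Na1 NaN L1 L2 => x; lra.
have pq0 : 0 <= p + q + 1 by lra.
have LNa : - (2 * L%:R) <= - (2 * N%:R `^ a) by lra.
have HS := bump_exponential_sum m1 mp mq N00 L0 z1 eta0 hz.
set S := normc _ in HS *.
have HS2 : S <= 4 * N%:R * expR (- (2 * N%:R `^ a)).
  apply: le_trans HS _; apply: ler_pM => //.
    rewrite exprn_ge0// divr_ge0 ?mulr_ge0 ?powR_ge0 ?(ltW N0) ?(ltW g0)//.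
  apply: (@le_trans _ _ (expR (- 2) ^+ L)).
    rewrite lerXn2r ?nnegrE ?expR_ge0//.
    by rewrite divr_ge0 ?mulr_ge0 ?powR_ge0 ?(ltW N0) ?(ltW g0).
  by rewrite -expRM_natl ler_expR mulrN mulrC.
have A1 : (bump_sum p q N)^-1 <= (bump_floor p q)^-1.
  rewrite lef_pV2 ?posrE//; first exact: (bump_sum_ge m1 mp mq).
  exact: lt_le_trans f0 (bump_sum_ge m1 mp mq N2).
rewrite -mulrA; apply: ler_pM => //; rewrite ?normc_ge0//.
  by rewrite invr_ge0 (le_trans (ltW f0))// (bump_sum_ge m1 mp mq).
apply: le_trans HS2 _; rewrite -!mulrA ler_wpM2l//.
rewrite (_ : - (2 * N%:R `^ a) = - N%:R `^ a + - N%:R `^ a); last by ring.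
rewrite expRD mulrA ler_wpM2r ?expR_ge0//.
by rewrite expRN ler_pdivrMr ?expR_gt0// HCj.
Qed.

Lemma expR_le_inv_sq (u : R) : 0 < u -> expR (- u) <= 4 / u ^+ 2.
Proof.
move=> u0; rewrite expRN -[leRHS]invrK lef_pV2 ?posrE ?expR_gt0 ?invr_gt0 ?divr_gt0 ?exprn_gt0//.
rewrite invf_div ler_pdivrMr// mulrC.
by apply: le_trans (exprn_le_expR (j := 2) isT (ltW u0)) _; rewrite -natrX.
Qed.

Lemma smooth_real_continuous d (g : 'rV[R]_d -> R) :
  smooth_real (g : 'rV[R]_d -> R^o) -> continuous g.
Proof. by move=> sg x; exact: differentiable_continuous (sg [::] x). Qed.

End decay.

Section error_term.
Context {R : realType}.

(** Of the two halves of exp (- c W^w), one yields W^-2. The other is already below exp (- N^a) when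
    (c / 2) W^w >= N^a; otherwise the divisor is at least g N^-eps and the window average decays by
    itself. *)
Lemma fourier_term_decay d (nrm : 'rV[R]_d -> R) (f : 'rV[R]_d -> R[i])
    (a gamma : R) (rho : 'rV[R]_d) (p q m : R) :
  (0 < d)%N -> is_norm nrm -> periodic_fun f ->
  continuous (fun x => complex.Re (f x)) -> continuous (fun x => complex.Im (f x)) ->
  super_analytic nrm f -> 0 < a < 1 -> 0 < gamma ->
  (forall k : 'rV[int]_d, k != 0 ->
    gamma / (wt k)%:R ^+ 2 <= normc (1 - e2pi (dotp k rho))) ->
  1 <= m -> 4 / (1 - a) <= m -> m <= p -> m <= q ->
  exists2 C : R, 0 <= C & exists N0 : nat, forall N : nat, (N0 <= N)%N ->
  forall k : 'rV[int]_d, k != 0 ->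
    normc (fourier_coef f k) * ((bump_sum p q N)^-1 *
      normc (\sum_(n < N) (bump_ext p q 0 (n%:R / N%:R))%:C * e2pi (dotp k rho) ^+ n))
    <= C * ((wt k)%:R ^+ 2)^-1 * expR (- N%:R `^ a).
Proof.
move=> d0 Hn fper cRe cIm fsa /andP[a0 a1] g0 dioph m1 ma mp mq.
(* This choice gives 2 a / w = a (1 - a) / 4, which is at most [eps]. *)
pose w := 8 / (1 - a).
have a1' : 0 < 1 - a by lra.
have w8 : 8 <= w by rewrite /w ler_pdivlMr//; lra.
have w1 : 1 < w by lra.
have w0 : 0 < w by lra.
have [C1 [c [C10 c0 HC1]]] := fourier_coef_decay d0 Hn fper cRe cIm fsa w1.
(* As a / m is also at most (1 - a) / 4, the exponent a (1 + 1/m) + eps is at most a + (1 - a) / 2 <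
   1. *)
pose eps := (1 - a) / 4.
have eps0 : 0 < eps by rewrite /eps; lra.
pose g := gamma * (c / 4) `^ (2 / w).
have g'0 : 0 < g by rewrite mulr_gt0// powR_gt0// divr_gt0.
have mV : m^-1 <= (1 - a) / 4.
  rewrite -[leRHS]invrK invf_div lef_pV2 ?posrE ?divr_gt0//; lra.
have hexp : a * (1 + m^-1) + eps < 1.
  have mV0 : 0 <= m^-1 by rewrite invr_ge0; lra.
  have : a * m^-1 <= (1 - a) / 4.
    by apply: le_trans mV; rewrite ler_piMl// ltW.
  rewrite /eps mulrDr mulr1; lra.
have a01 : 0 < a < 1 by rewrite a0 a1.
have [C2 C20 [N2 HN2]] := weighted_sum_decay m1 mp mq a01 g'0 hexp.
exists (C1 * (16 / c ^+ 2) * (1 + C2)).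
  by rewrite mulr_ge0 ?addr_ge0// mulr_ge0// divr_ge0// exprn_ge0// ltW.
exists (maxn 2 N2) => N; rewrite geq_max => /andP[N2' NN2] k k0.
have NR : 1 <= N%:R :> R by rewrite ler1n ltnW.
have N0 : 0 < N%:R :> R by lra.
pose W : R := (wt k)%:R.
have W1 : 1 <= W by rewrite ler1n wt_gt0.
have W0 : 0 < W by lra.
have WW : W <= W `^ w by apply: le1r_powR => //; exact: ltW.
set T := (bump_sum p q N)^-1 * _.
have A0 : 0 < bump_sum p q N := lt_le_trans (expR_gt0 _) (bump_sum_ge m1 mp mq N2').
have T0 : 0 <= T by rewrite mulr_ge0 ?invr_ge0 ?normc_ge0// ltW.
have T1 : T <= 1 by apply: (weighted_sum_le1 m1 mp mq N2'); exact: normc_e2pi.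
have half : expR (- (c / 2 * W `^ w)) <= 16 / c ^+ 2 / W ^+ 2.
  apply: (@le_trans _ _ (expR (- (c / 2 * W)))).
    by rewrite ler_expR lerN2 ler_pM2l// divr_gt0.
  have cW : 0 < c / 2 * W by rewrite mulr_gt0// divr_gt0.
  apply: le_trans (expR_le_inv_sq cW) _.
  rewrite le_eqVlt; apply/orP; left; apply/eqP; field.
  by rewrite (gt_eqF W0) (gt_eqF c0).
have FE : normc (fourier_coef f k) <=
    C1 * (expR (- (c / 2 * W `^ w)) * expR (- (c / 2 * W `^ w))).
  rewrite -expRD (_ : _ + _ = - (c * W `^ w)); first exact: HC1.
  by field.
have E0 : 0 <= 16 / c ^+ 2 / W ^+ 2 by exact: le_trans (expR_ge0 _) half.
rewrite -/W.
have -> : C1 * (16 / c ^+ 2) * (1 + C2) * (W ^+ 2)^-1 * expR (- N%:R `^ a) =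
    C1 * (16 / c ^+ 2 / W ^+ 2) * ((1 + C2) * expR (- N%:R `^ a)) by ring.
suff key : expR (- (c / 2 * W `^ w)) * T <= (1 + C2) * expR (- N%:R `^ a).
  apply: (@le_trans _ _ (C1 * (expR (- (c / 2 * W `^ w)) * expR (- (c / 2 * W `^ w))) * T)).
    by rewrite ler_wpM2r.
  rewrite -[leLHS]mulrA -[leRHS]mulrA ler_wpM2l// -[leLHS]mulrA.
  by apply: ler_pM => //; apply: mulr_ge0.
have [big|small] := lerP (N%:R `^ a) (c / 2 * W `^ w).
  apply: (@le_trans _ _ (expR (- N%:R `^ a) * 1)).
    by rewrite ler_pM ?expR_ge0// ler_expR lerN2.
  by rewrite mulrC ler_wpM2r ?expR_ge0// lerDl.
apply: (@le_trans _ _ (1 * T)).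
  rewrite ler_wpM2r// -expR0 ler_expR oppr_le0 mulr_ge0 ?powR_ge0//.
  by rewrite divr_ge0// ltW.
rewrite mul1r; apply: le_trans (_ : C2 * expR (- N%:R `^ a) <= _); last first.
  by rewrite ler_wpM2r ?expR_ge0// lerDr.
apply: HN2 => //; first exact: normc_e2pi.
apply: le_trans (dioph k k0); rewrite /g -mulrA ler_pM2l//.
have X0 : 0 <= 2 / w by rewrite divr_ge0// ltW.
(* [W] is at most [(2 N^a / c)^(1/w)] and [2 a / w <= eps]. *)
have h1 : (c / 4 * W `^ w) `^ (2 / w) <= N%:R `^ eps.
  apply: (@le_trans _ _ ((N%:R `^ a) `^ (2 / w))).
    have c4 : 0 <= c / 4 by rewrite divr_ge0// ltW.
    apply: (ge0_ler_powR X0); rewrite ?nnegrE ?powR_ge0//.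
      by apply: mulr_ge0 => //; exact: powR_ge0.
    have := powR_ge0 W w; move: (W `^ w) (N%:R `^ a) small => x y small x0; nra.
  rewrite -powRrM; apply: ler_powR => //.
  rewrite /eps /w invf_div.
  have : a * (1 - a) <= 1 - a by rewrite ler_piMl ?ltW.
  lra.
have W2 : (W `^ w) `^ (2 / w) = W ^+ 2.
  by rewrite -powRrM mulrC divfK ?(gt_eqF w0)// -powR_mulrn// ltW.
rewrite powRM ?powR_ge0 ?divr_ge0 ?(ltW c0)// W2 in h1.
rewrite -/W powRN ler_pdivrMr ?powR_gt0// [leRHS]mulrC.
by rewrite ler_pdivlMr ?exprn_gt0.
Qed.

End error_term.

Theorem theorem6p2 (R : realType) :
  exists2 c : R, 0 < c &
  forall (d : nat) (nrm : 'rV[R]_d -> R) (f : 'rV[R]_d -> R[i]) (a : R),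
    (0 < d)%N -> is_norm nrm ->
    periodic_fun f -> smooth f -> super_analytic nrm f ->
    0 < a < 1 ->
    almost_all_torus (fun rho : 'rV[R]_d =>
      exists2 m : R, 1 <= m &
      forall p q : R, m <= p -> m <= q ->
      forall theta : 'rV[R]_d,
        (birkhoff_error p q f rho theta : nat -> R^o) =O_\oo
        ((fun N : nat => expR (- (c * N%:R `^ a))) : nat -> R^o)).
Proof.
exists 1 => // d nrm f a d0 Hn fper [sRe sIm] fsa a01.
have cRe : continuous (fun x => complex.Re (f x)) := smooth_real_continuous sRe.
have cIm : continuous (fun x => complex.Im (f x)) := smooth_real_continuous sIm.
apply: negligibleS (@diophantine_ae R d) => y /= resonant [gamma g0 dioph].
apply: resonant.
(* This threshold depends on a alone: the same p and q serve almost every rotation. *)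
exists (Num.max 1 (4 / (1 - a))); first by rewrite le_max lexx.
move=> p q mp mq theta.
have m1 : 1 <= Num.max 1 (4 / (1 - a)) by rewrite le_max lexx.
have ma : 4 / (1 - a) <= Num.max 1 (4 / (1 - a)) by rewrite le_max lexx orbT.
have [C C0 [N0 HN0]] :=
  fourier_term_decay d0 Hn fper cRe cIm fsa a01 g0 dioph m1 ma mp mq.
(* The 4^d is the sum of W(k)^-2 over any box; the added 1 makes the constant positive. *)
apply/eqO_exP; exists (C * 4 ^+ d + 1).
  by rewrite ltr_wpDl// mulr_ge0// exprn_ge0.
near=> N.
have NN0 : (N0 <= N)%N by near: N; exact: nbhs_infty_ge.
have N2 : (1 < N)%N by near: N; exact: nbhs_infty_ge.
rewrite mul1r (@ger0_norm _ (expR _)) ?expR_ge0//.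
rewrite ger0_norm; last exact: normc_ge0.
apply: (birkhoff_error_le theta m1 mp mq N2 fper cRe cIm) => K.
apply: (@le_trans _ _ (\sum_(phi : {ffun 'I_d -> 'I_(K.*2.+1)})
    C * ((wt (freq phi))%:R ^+ 2)^-1 * expR (- N%:R `^ a))).
  rewrite [leRHS](bigID (fun phi => freq phi != 0)) /= -[leLHS]addr0 lerD//.
    by apply: ler_sum => phi phi0; exact: HN0.
  by apply: sumr_ge0 => phi _; rewrite mulr_ge0 ?expR_ge0// mulr_ge0// invr_ge0 exprn_ge0.
rewrite -mulr_suml -mulr_sumr ler_wpM2r ?expR_ge0//.
apply: (@le_trans _ _ (C * 4 ^+ d)); last by rewrite lerDl.
by rewrite ler_wpM2l// box_sum_le.
Unshelve. all: by end_near.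
Qed.
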